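(* Let $d\geq 2$ and let $\mathbf{k}=(k_1,\dots,k_{d+1})$ be a sequence of positive integers. Then the simplicial complex $T_{\mathbf{k}}$ is a triangulation of the $d$-dimensional torus, the generalized Heawood graph $G_{\mathbf{k}}$ is (isomorphic to) the dual graph of $T_{\mathbf{k}}$, and the $f$-vector $(f_0,f_1,\dots,f_d)$ of $T_{\mathbf{k}}$ is given by \[ f_i=i!\,S(d+1,i+1)\,D_{\mathbf{k}}, \qquad 0\le i\le d, \] where $S(n,m)=\frac{1}{m!}\sum_{j=1}^{m}(-1)^{m-j}\binom{m}{j}j^n$ is the Stirling number of the second kind and $D_{\mathbf{k}}=\det M_{\mathbf{k}}=\prod(k_i+1)-\prod k_i$. In particular $f_0=D_{\mathbf{k}}$, $f_d=d!\,D_{\mathbf{k}}$ and $f_{d-1}=\frac{(d+1)!}{2}D_{\mathbf{k}}$.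
   Context: Let $e_1,\dots,e_{d+1}$ be the standard basis of $\mathbb{R}^{d+1}$, $w_i=(d+1)e_i-\sum_j e_j$ and $\widetilde w_i=w_i/(d+1)$. $M_{\mathbf{k}}$ is the $(d+1)\times(d+1)$ integer matrix whose $i$-th row has entry $k_i+1$ in column $i$, entry $-k_{i+1}$ in column $i+1$ (indices cyclic mod $d+1$), zeros elsewhere. Let $L_{\mathbf{k}}=\{\sum a_iw_i : a=bM_{\mathbf{k}},\ b\in\mathbb{Z}^{d+1}\}$ and $\widetilde L_{\mathbf{k}}=\{\sum a_i\widetilde w_i : a=bM_{\mathbf{k}},\ b\in\mathbb{Z}^{d+1}\}$. Let $V=\{\mathbf{x}\in\mathbb{R}^{d+1}:\sum x_i=0\}$ and let $\Sigma_d$ be the infinite simplicial complex (triangulation of $V$) cut out by the affine hyperplanes $\{\mathbf{x}\in V: x_j-x_i=m\}$, $1\le i<j\le d+1$, $m\in\mathbb{Z}$; its vertex set is the lattice $\{\mathbf{x}\in V: x_j-x_i\in\mathbb{Z}\ \forall i,j\}$ spanned by the $\widetilde w_i$. $T_{\mathbf{k}}$ is the complex whose faces are the equivalence classes of faces of $\Sigma_d$ under translation by vectors of $\widetilde L_{\mathbf{k}}$, a class being contained in another if some representative of the first is contained in some representative of the second. Let $\Gamma_d$ be the infinite graph whose vertices are the integer vectors $\mathbf{x}$ with $\sum x_i=1+\dots+(d+1)$ whose coordinates form a complete residue system mod $d+1$, with $\mathbf{x}\sim\mathbf{y}$ iff $\mathbf{y}-\mathbf{x}=e_j-e_i$, $i\ne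 j$; $G_{\mathbf{k}}$ is the graph of classes of vertices and edges of $\Gamma_d$ modulo translation by $L_{\mathbf{k}}$. The dual graph of a simplicial complex has the facets as vertices, two facets adjacent iff they share a codimension-one face. *)

(* Defs.v *)
From HB Require Import structures.
From mathcomp Require Import all_boot all_order all_algebra.
From mathcomp Require Import finmap.
From mathcomp Require Import all_classical all_reals all_analysis.

Set Implicit Arguments.
Unset Strict Implicit.
Unset Printing Implicit Defensive.

Import Order.TTheory GRing.Theory Num.Theory.
Import numFieldNormedType.Exports.

Local Open Scope classical_set_scope.
Local Open Scope ring_scope.

(* The coordinates 1, ..., d+1 are indexed by 'I_d.+1, and [ordS] is the
   cyclic successor on indices. *)

Definition stirling2 (n m : nat) : rat :=
  (m`!%:R)^-1 *
  \sum_(1 <= j < m.+1) (-1) ^+ (m - j) * 'C(m, j)%:R * j%:R ^+ n.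

(* A complex is presented by its non-empty faces and their containment
   relation. *)
Record complex := Complex {
  face_type : choiceType;
  faces : set face_type;
  contained : face_type -> face_type -> Prop }.

Definition vertices (K : complex) : set (face_type K) :=
  [set v | faces v /\ forall F, faces F -> contained F v -> F = v].

Definition vertices_of (K : complex) (F : face_type K) : set (face_type K) :=
  [set v | vertices v /\ contained v F].

(* K is (the face poset of) an abstract simplicial complex: sending a face to
   its vertex set identifies the faces, ordered by containment, with a family
   of finite non-empty sets, ordered by inclusion and closed under taking
   non-empty subsets. *)
Definition simplicial_complex (K : complex) : Prop :=
  [/\ forall F : face_type K, faces F ->
        finite_set (vertices_of F) /\ vertices_of F !=set0,
      forall F G : face_type K, faces F -> faces G ->
        (contained F G <-> vertices_of F `<=` vertices_of G),
      forall F G : face_type K, faces F -> faces G ->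
        vertices_of F = vertices_of G -> F = G
    & forall (F : face_type K) (S : set (face_type K)), faces F ->
        S !=set0 -> S `<=` vertices_of F ->
        exists2 G, faces G & vertices_of G = S].

Definition finite_complex (K : complex) : Prop := finite_set (@faces K).

Definition face_dim (K : complex) (F : face_type K) : nat :=
  #|` fset_set (vertices_of F)|.-1.

(* [fset_set] is only meaningful for finite sets: this is the number of
   i-dimensional faces when K is finite. *)
Definition f_vector (K : complex) (i : nat) : nat :=
  #|` fset_set [set F : face_type K | faces F /\ face_dim F = i]|.

Definition facets (K : complex) : set (face_type K) :=
  [set F | faces F /\ forall G, faces G -> contained F G -> G = F].

(* Barycentric coordinates on the vertices. For finite complexes, the only
   ones considered in [triangulation_of], the topology induced by pointwise
   convergence is the usual topology of the geometric realization. *)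
Definition realization (R : realType) (K : complex) :
    set {ptws face_type K -> R} :=
  [set t | exists F : face_type K,
    [/\ faces F,
        forall v, 0 <= t v,
        forall v, t v != 0 -> vertices_of F v
      & \sum_(v \in vertices_of F) t v = 1]].

Definition homeomorphic (X Y : topologicalType) (A : set X) (B : set Y) : Prop :=
  exists (f : X -> Y) (g : Y -> X),
    [/\ {within A, continuous f}, {within B, continuous g},
        forall x, A x -> B (f x) /\ g (f x) = x
      & forall y, B y -> A (g y) /\ f (g y) = y].

Definition triangulation_of (R : realType) (K : complex)
    (X : topologicalType) (A : set X) : Prop :=
  [/\ simplicial_complex K, finite_complex K
    & homeomorphic (@realization R K) A].

(* The product of d unit circles of R^2; row i holds the point of the i-th
   circle. *)
Definition torus (R : realType) (d : nat) : set 'M[R]_(d, 2) :=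
  [set x : 'M[R]_(d, 2) | forall i : 'I_d, x i 0 ^+ 2 + x i 1 ^+ 2 = 1].

(* Loops and parallel edges are allowed. *)
Record graph := Graph {
  node_type : Type;
  edge_type : Type;
  nodes : set node_type;
  edges : set edge_type;
  incident : node_type -> edge_type -> Prop }.

Definition graph_isomorphic (G H : graph) : Prop :=
  exists (phi : node_type G -> node_type H) (psi : edge_type G -> edge_type H),
    [/\ set_bij (@nodes G) (@nodes H) phi,
        set_bij (@edges G) (@edges H) psi
      & forall v e, nodes v -> edges e ->
          (incident v e <-> incident (phi v) (psi e))].

Definition share_codim1_face (K : complex) (F G : face_type K) : Prop :=
  exists E : face_type K,
    [/\ faces E, contained E F, contained E G,
        (face_dim E).+1 = face_dim F & (face_dim E).+1 = face_dim G].

Definition dual_graph (K : complex) : graph :=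
  {| nodes := @facets K;
     edges := [set e : set (face_type K) | exists F G,
       [/\ facets F, facets G, F <> G, share_codim1_face F G
         & e = [set F; G]]];
     incident := fun F e => e F |}.

Definition translate (V : zmodType) (v : V) (F : set V) : set V :=
  [set x + v | x in F].

Definition set_class (V : zmodType) (L : set V) (F : set V) : set (set V) :=
  [set translate v F | v in L].

Definition std_basis (A : pzRingType) (d : nat) (i : 'I_d.+1) : 'rV[A]_d.+1 :=
  delta_mx 0 i.

Definition w_vec (A : pzRingType) (d : nat) (i : 'I_d.+1) : 'rV[A]_d.+1 :=
  d.+1%:R *: std_basis A i - \sum_j std_basis A j.

Definition wt_vec (R : realType) (d : nat) (i : 'I_d.+1) : 'rV[R]_d.+1 :=
  d.+1%:R^-1 *: w_vec R i.

Definition Mk (d : nat) (k : 'I_d.+1 -> nat) : 'M[int]_d.+1 :=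
  \matrix_(i, j) if j == i then (k i).+1%:Z
                 else if j == ordS i then - (k (ordS i))%:Z
                 else 0.

Definition Dk (d : nat) (k : 'I_d.+1 -> nat) : int := \det (Mk k).

Definition Lk (d : nat) (k : 'I_d.+1 -> nat) : set 'rV[int]_d.+1 :=
  [set x | exists b : 'rV[int]_d.+1,
    x = \sum_i (b *m Mk k) 0 i *: w_vec int i].

Definition Ltk (R : realType) (d : nat) (k : 'I_d.+1 -> nat) :
    set 'rV[R]_d.+1 :=
  [set x | exists b : 'rV[int]_d.+1,
    x = \sum_i ((b *m Mk k) 0 i)%:~R *: wt_vec R i].

Definition hyperplane_V (R : realType) (d : nat) : set 'rV[R]_d.+1 :=
  [set x : 'rV[R]_d.+1 | \sum_i x 0 i = 0].

(* The relatively open cell of x: the points of V lying on the same side as x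
   of (or, like x, on) each hyperplane x_j - x_i = m. *)
Definition open_cell (R : realType) (d : nat) (x : 'rV[R]_d.+1) :
    set 'rV[R]_d.+1 :=
  [set y | hyperplane_V y /\
    forall (i j : 'I_d.+1) (m : int), (i < j)%N ->
      Num.sg (y 0 j - y 0 i - m%:~R) = Num.sg (x 0 j - x 0 i - m%:~R)].

Definition Sigma_faces (R : realType) (d : nat) : set (set 'rV[R]_d.+1) :=
  [set F | exists2 x, hyperplane_V x & F = closure (open_cell x)].

Definition Tk (R : realType) (d : nat) (k : 'I_d.+1 -> nat) : complex :=
  {| faces := [set set_class (@Ltk R d k) F | F in @Sigma_faces R d];
     contained := fun C C' => exists F F', [/\ C F, C' F' & F `<=` F'] |}.

Definition Gamma_vertices (d : nat) : set 'rV[int]_d.+1 :=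
  [set x : 'rV[int]_d.+1 | \sum_i x 0 i = \sum_(1 <= j < d.+2) j%:Z /\
    forall r : int, exists! i : 'I_d.+1, (x ord0 i = r %[mod d.+1%:Z])%Z].

Definition Gamma_adj (d : nat) (x y : 'rV[int]_d.+1) : Prop :=
  exists i j : 'I_d.+1, i != j /\ y - x = std_basis int j - std_basis int i.

Definition Gamma_edges (d : nat) : set (set 'rV[int]_d.+1) :=
  [set e | exists x y,
    [/\ Gamma_vertices x, Gamma_vertices y, Gamma_adj x y & e = [set x; y]]].

(* The class of a vertex x is the coset x + L_k; an edge class is incident to
   the classes of the end points of its representatives. *)
Definition Gk (d : nat) (k : 'I_d.+1 -> nat) : graph :=
  {| nodes := [set translate x (Lk k) | x in @Gamma_vertices d];
     edges := [set set_class (Lk k) e | e in @Gamma_edges d];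
     incident := fun X E => exists x e, [/\ X x, E e & e x] |}.

(* Main.v *)
(** Coordinates matter only through their differences. The closed cell of [x] is
    governed by the roundings up of the differences [x_j - x_i] (the preorder
    [cell_le]); its vertices are the roundings down of [x - x_i], and the
    barycentric coordinate of [x] at a vertex [u] is the hat function
    [max (0, 1 - spread (x - u))], where the spread of a vector is its maximum minus
    its minimum. A non-zero period has spread at least 3, so the star of a vertex
    embeds in the quotient. Hence T_k is a simplicial complex, and the hat functions
    induce a continuous periodic map from V onto its realization; comparing it with
    [t |-> (cos 2 pi t, sin 2 pi t)] on a fundamental cube gives the homeomorphism
    with the torus.

    The cells with m vertices are those of the points X / m, where X is an integer
    vector whose coordinates meet every residue class mod m. Modulo periods they are
    counted by the cosets of the row lattice of M_k (Smith normal form) and the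
    surjections onto m classes with one prescribed value. For m = d+1 these X are the
    vertices of Gamma_d, up to a constant vector; such an X is determined by the
    quotients of X_w - X_u by d+1, and crossing a ridge changes them for only one
    pair of coordinates. *)
Require Import Defs.
From HB Require Import structures.
From mathcomp Require Import all_boot all_order all_algebra.
From mathcomp Require Import finmap perm zify ring lra.
From mathcomp Require Import all_classical all_reals all_analysis.

Set Implicit Arguments.
Unset Strict Implicit.
Unset Printing Implicit Defensive.

Import Order.TTheory GRing.Theory Num.Theory.
Import numFieldNormedType.Exports.

Local Open Scope classical_set_scope.
Local Open Scope ring_scope.

(** * Determinant, index and surjections *)

(** Everything is taken modulo constant vectors. [V] is R^(d+1) modulo constants and its vertices
    are Z^(d+1) modulo constants. Since the rows of [Mk k] sum to (1, ..., 1), this matrix fixes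
    constants. So the constants lie in its row lattice, the index D_k of that lattice in Z^(d+1) is
    also the index of the periods among the vertices, and the rows other than the first already
    generate all periods. The main obstacle is to recover a face of the quotient from its vertex
    classes. Two faces with matching vertex classes are a priori matched by a different period at
    each vertex. Two such periods differ by a difference of two edge vectors, each of spread at most
    1, so it is periods of spread at most 2 that must be excluded; positivity of the k_i does
    exactly this. The same bound excludes loops and parallel edges in G_k, whereas the edges of a
    dual graph are by definition pairs of distinct facets. For the topology, one compact cube maps
    continuously onto both the realization and the torus with the same fibres. Both targets being
    Hausdorff, each is the quotient of the cube, so neither direction of the homeomorphism needs an
    explicit formula. *)

Section MkTheory.
Variables (d : nat) (k : 'I_d.+1 -> nat).
Hypothesis d_gt0 : (0 < d)%N.

Lemma ordS_neq (i : 'I_d.+1) : ordS i != i.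
Proof.
apply/eqP => /(congr1 val) /=.
have [->|ne] := eqVneq (i : nat) d; first by rewrite modnn; lia.
by rewrite modn_small; have := ltn_ord i; lia.
Qed.

(** Column [j] is non-zero only in rows [j] and [ord_pred j]. In this form, [Mk k] pushes each entry
    away from its cyclic predecessor, and constants are visibly fixed. *)
Lemma mulmx_Mk (b : 'rV[int]_d.+1) (j : 'I_d.+1) :
  (b *m Mk k) 0 j =
  b 0 j + (k j)%:Z * (b 0 j - b 0 (ord_pred j)).
Proof.
rewrite mxE (bigD1 j)//= (bigD1 (ord_pred j))/=; last first.
  by apply/eqP => e; have := ordS_neq (ord_pred j); rewrite ord_predK e eqxx.
rewrite big1 => [|i /andP[ij ij']].
  rewrite !mxE eqxx ord_predK.
  have /negPf -> : j != ord_pred j.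
    by have := ordS_neq (ord_pred j); rewrite ord_predK.
  by rewrite eqxx addr0; ring.
rewrite mxE eq_sym (negPf ij) -(can2_eq (@ord_predK _) (@ordSK _)).
by rewrite eq_sym (negPf ij') mulr0.
Qed.

Lemma mul_const_Mk (c : int) : const_mx c *m Mk k = const_mx c :> 'rV_d.+1.
Proof. by apply/rowP => j; rewrite mulmx_Mk !mxE; ring. Qed.

(* At a cyclic ascent to the maximum of [b] the image exceeds [max b], and at a
   descent to the minimum it is below [min b]. *)
Lemma Mk_spread (b : 'rV[int]_d.+1) : (forall i, 0 < k i)%N ->
  (forall i j, (b *m Mk k) 0 i - (b *m Mk k) 0 j <= 2) ->
  exists c, b = const_mx c.
Proof.
move=> k_gt0 bM.
pose imax := [arg max_(i > ord0) b 0 i]%O; pose imin := [arg min_(i < ord0) b 0 i]%O.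
have bmax i : b 0 i <= b 0 imax.
  by rewrite /imax; case: arg_maxP => // j _ /(_ i isT).
have bmin i : b 0 imin <= b 0 i.
  by rewrite /imin; case: arg_minP => // j _ /(_ i isT).
have [e|ne] := eqVneq (b 0 imin) (b 0 imax).
  exists (b 0 imax); apply/rowP => i; rewrite mxE; apply/eqP.
  by rewrite eq_le bmax -e bmin.
have reach (i : 'I_d.+1) (j : 'I_d.+1) : exists m, iter m (@ordS _) i = j.
  exists (j + (d.+1 - i))%N; apply: val_inj.
  have E m : (val (iter m (@ordS d.+1) i) = (i + m) %% d.+1)%N.
    elim: m => [|m IH]; first by rewrite addn0 modn_small.
    rewrite iterS -[LHS]/((\val (iter m (@ordS d.+1) i)).+1 %% d.+1)%N IH.
    by rewrite -[X in (X %% _)%N]addn1 modnDml -addnA addn1.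
  rewrite E; have := ltn_ord i => ltid.
  rewrite (_ : (i + (j + (d.+1 - i)))%N = (j + d.+1)%N); last by lia.
  by rewrite modnDr modn_small.
(* Going around the cycle, a predicate that is false somewhere and true somewhere must switch from
   false to true. *)
have step (P : pred 'I_d.+1) i0 j0 : ~~ P i0 -> P j0 ->
    exists j, P j && ~~ P (ord_pred j).
  move=> Pi0 Pj0; have [m] := reach i0 j0.
  elim: m => [|m IH] in j0 Pj0 *; first by move=> e; rewrite -e /= (negPf Pi0) in Pj0.
  rewrite iterS => e; have [Pm|nPm] := boolP (P (iter m (@ordS _) i0)).
    exact: (IH _ Pm).
  by exists j0; rewrite Pj0 -e ordSK.
have [j /andP[/eqP jmax jpred]] :=
  step (fun i => b 0 i == b 0 imax) imin imax ne (eqxx _).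
have [l /andP[/eqP lmin lpred]] : exists j,
  (b 0 j == b 0 imin) && (b 0 (ord_pred j) != b 0 imin).
  by apply: (step (fun i => b 0 i == b 0 imin) imax imin) => //; rewrite eq_sym.
(* The image is at least [max b + 1] at [j] and at most [min b - 1] at [l]. As [max b - min b] is at
   least 1, the two values differ by at least 3. *)
have := bM j l; rewrite !mulmx_Mk jmax lmin.
have h1 : b 0 (ord_pred j) < b 0 imax by rewrite lt_neqAle jpred bmax.
have h2 : b 0 imin < b 0 (ord_pred l) by rewrite lt_neqAle eq_sym lpred bmin.
have := k_gt0 j; have := k_gt0 l; have := bmax imin.
move: (k j) (k l) (b 0 imax) (b 0 imin) (b 0 (ord_pred j)) (b 0 (ord_pred l)) ne h1 h2.
clear; move=> kj kl x y z t; lia || nia.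
Qed.

(** The first column has only two non-zero entries, in the first and the last row, and both minors
    are triangular, with diagonals made of the [k_i + 1] and of the [- k_i]. The signs of the second
    minor cancel against that of its cofactor. *)
Lemma det_Mk : Dk k = \prod_i (k i).+1%:Z - \prod_i (k i)%:Z.
Proof.
rewrite /Dk; move: k d_gt0; case: d => // n k' _.
rewrite (expand_det_col _ ord0) big_ord_recl big_ord_recr/= big1 => [|i _]; last first.
  rewrite !mxE ifF ?ifF ?mul0r//.
  apply/negP => /eqP /(congr1 val) /=.
  by rewrite modn_small /bump /=; have := ltn_ord i; lia.
have -> : Mk k' ord0 ord0 = (k' ord0).+1%:Z by rewrite mxE eqxx.
have -> : Mk k' (lift ord0 ord_max) ord0 = - (k' ord0)%:Z.
  have Smax : ordS (lift ord0 ord_max) = ord0 :> 'I_n.+2.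
    by apply: val_inj; rewrite /= /bump leq0n add1n modnn.
  by rewrite mxE Smax eqxx.
rewrite add0r /cofactor.
have -> : \det (row' ord0 (col' ord0 (Mk k'))) = \prod_(i < n.+1) (k' (lift ord0
  i)).+1%:Z.
  rewrite -det_tr det_trig; last first.
    apply/is_trig_mxP => i j ij; rewrite !mxE (inj_eq lift_inj) ifF ?ifF//.
      apply/negP => /eqP /(congr1 val) /=; rewrite /bump !leq0n !add1n.
      have [->|nj] := eqVneq (j : nat) n; first by rewrite modnn.
      have jn : (j < n)%N by rewrite ltn_neqAle nj -ltnS ltn_ord.
      by rewrite modn_small// => -[ij']; move: ij; rewrite ij' ltnNge leqnSn.
    by apply/negP => /eqP e; rewrite e ltnn in ij.
  by apply: eq_bigr => i _; rewrite !mxE eqxx.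
have -> : \det (row' (lift ord0 ord_max) (col' ord0 (Mk k'))) =
    (-1) ^+ n.+1 * \prod_(i < n.+1) (k' (lift ord0 i))%:Z.
  have lE (i : 'I_n.+1) : lift (lift ord0 ord_max) i = i :> nat.
    by rewrite /= /bump leq0n add1n leqNgt ltn_ord.
  have SE (i : 'I_n.+1) : ordS (lift (lift ord0 ord_max) i) = lift ord0 i.
    apply: val_inj; rewrite -[LHS]/((nat_of_ord (lift (lift ord0 ord_max) i)).+1 %%
      n.+2)%N lE.
    rewrite /= /bump leq0n add1n modn_small//.
    by have := ltn_ord i; lia.
  rewrite det_trig.
    rewrite -[X in _ ^+ X]card_ord -prodrN.
    apply: eq_bigr => i _; rewrite !mxE SE eqxx ifF//.
    by apply/negP => /eqP /(congr1 (@nat_of_ord _)); rewrite lE /= /bump; lia.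
  apply/is_trig_mxP => i j ij; rewrite !mxE SE (inj_eq lift_inj) ifF ?ifF//.
    by apply/negP => /eqP e; rewrite e ltnn in ij.
  apply/negP => /eqP /(congr1 (@nat_of_ord _)); rewrite lE /= /bump leq0n add1n => e.
  by rewrite -e ltnNge leqnSn in ij.
rewrite /= addn0 expr0 mul1r /bump leq0n add1n.
rewrite addn0 !big_ord_recl [X in _ + _ * X]mulrA -exprMn mulrNN mulr1 expr1n mul1r;
  ring.
Qed.

Lemma Dk_gt0 : 0 < Dk k.
Proof.
rewrite det_Mk subr_gt0; apply: ltr_prod => [|i _]; last by rewrite ltz_nat ltnSn.
by apply/hasP; exists ord0; rewrite ?mem_index_enum.
Qed.

End MkTheory.

(** In a Smith form [M = L D R] the unimodular [L] does not change the row lattice. The cosets are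
    therefore represented by the vectors of remainders modulo the diagonal entries of [D],
    multiplied by [R]. *)
Lemma lattice_index n (M : 'M[int]_n) : \det M != 0 ->
  exists (T : finType) (rep : T -> 'rV[int]_n),
    [/\ #|T| = `|\det M|%N,
        forall a, exists t b, a = rep t + b *m M
      & forall t t' b, rep t = rep t' + b *m M -> t = t'].
Proof.
have [L uL [Rm uR [s _ ->]]] := int_Smith_normal_form M.
set D := \matrix_(i, j) _.
pose e (i : 'I_n) := absz (nth 0 s i).
have DE : D = diag_mx (\row_i s`_i) by apply/matrixP => i j; rewrite !mxE.
have det_unit (A : 'M[int]_n) : A \in unitmx -> `|\det A|%N = 1%N.
  rewrite unitmxE => uA; have /eqP := congr1 absz (mulrV uA).
  by rewrite abszM muln_eq1 => /andP[/eqP].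
have detE : `|\det (L *m D *m Rm)|%N = (\prod_(i < n) e i)%N%N.
  rewrite !det_mulmx !abszM (det_unit L)// (det_unit Rm)// mul1n muln1 DE det_diag.
  by elim/big_rec2: _ => [//|i x y _ <-]; rewrite abszM mxE /e.
move=> det_neq0.
have s_neq0 (i : 'I_n) : s`_i != 0.
  apply: contra det_neq0 => /eqP si0.
  by rewrite -absz_eq0 detE (bigD1 i)//= /e si0 mul0n.
exists {dffun forall i : 'I_n, 'I_(e i)}.
exists (fun t : {dffun forall i : 'I_n, 'I_(e i)} => \row_i (t i : nat)%:Z *m Rm);
  split.
- rewrite card_dep_ffun detE.
  have -> : [seq #|'I_(e x)| | x : 'I_n] = [seq e x | x : 'I_n].
    by apply: eq_map => x; rewrite card_ord.
  by rewrite -big_enum /= foldrE big_map.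
- move=> a; pose c := a *m invmx Rm.
  have m_lt i : (`|(c ord0 i %% s`_i)%Z| < e i)%N.
    by rewrite -ltz_nat gez0_abs ?modz_ge0// ltz_mod.
  exists [ffun i => Ordinal (m_lt i)].
  exists (\row_i (c ord0 i %/ s`_i)%Z *m invmx L).
  rewrite !mulmxA mulmxKV// -mulmxDl -[LHS](mulmxKV uR) -/c; congr (_ *m _).
  rewrite DE mul_mx_diag; apply/rowP => i;
  rewrite [RHS]mxE [X in X + _]mxE [X in _ + X]mxE [X in _ + X * _]mxE ffunE.
  by rewrite [X in _ * X]mxE /= gez0_abs ?modz_ge0// addrC -divz_eq.
- move=> t t' b /(congr1 (mulmx^~ (invmx Rm))).
  rewrite !mulmxA mulmxDl !mulmxK// DE => E.
  apply/ffunP => i; apply: val_inj => /=.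
  have := congr1 (fun M : 'rV__ => M 0 i) E.
  rewrite mul_mx_diag !mxE => {}E.
  have hx : (t i < `|(s`_i)%R|)%N := ltn_ord (t i).
  have hy : (t' i < `|(s`_i)%R|)%N := ltn_ord (t' i).
  move: (nat_of_ord (t i)) (nat_of_ord (t' i)) E hx hy => x y.
  move: (\sum_j _) (s`_i); clear => q z e hx hy.
  have [q0|q0] := eqVneq q 0; first by move: e; rewrite q0 mul0r addr0 => -[].
  have : (`|x%:Z - y%:Z| < `|z|)%R by lia.
  rewrite e addrAC subrr add0r normrM.
  have : 1 <= `|q| by lia.
  nia.
Qed.

Definition is_surj (aT rT : finType) (f : aT -> rT) : bool :=
  [forall c, exists i, f i == c].

(** Inclusion-exclusion: expand the product over [c] of 1 minus the indicator that [c] is missed.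
    The term of a set [J] survives only for the maps with values in [J]. *)
Lemma card_surj n m :
  #|[pred f : {ffun 'I_n -> 'I_m} | is_surj f]|%:R =
  \sum_(j < m.+1) (-1) ^+ (m - j) * 'C(m, j)%:R * j%:R ^+ n :> rat.
Proof.
have ind (f : {ffun 'I_n -> 'I_m}) : (is_surj f)%:R =
    \sum_(J : {set 'I_m}) (if f \in ffun_on (mem J) then (-1) ^+ (m - #|J|) else 0)
      :> rat.
  transitivity (\prod_(c : 'I_m) (1 + if [exists i, f i == c] then 0 else -1) : rat).
    have [/fintype.forallP fs|] := boolP (is_surj f).
      by rewrite big1 // => c _; rewrite fs addr0.
    by rewrite negb_forall => /fintype.existsP[c /negPf cP];
      rewrite (bigD1 c)//= cP subrr mul0r.
  rewrite bigA_distr; apply: eq_bigr => J _.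
  case: ifPn => [/ffun_onP fJ|].
    rewrite (bigID (mem J))/= big1 => [|c ->//]; rewrite mul1r.
    rewrite (eq_bigr (fun=> -1)) => [|c /negPf cJ].
      rewrite prodr_const; congr (_ ^+ _).
      have cJ : (#|J| + #|[predC J]| = m)%N by rewrite cardC card_ord.
      have <- : #|[predC J]| = (m - #|J|)%N by lia.
      exact: eq_card.
    rewrite cJ; case: ifPn => // /fintype.existsP[i /eqP e].
    have : c \in J by rewrite -e; exact: fJ.
    by rewrite cJ.
  move=> /ffun_onP nJ; have [i iJ] : exists i, f i \notin J.
    by apply: contrapT => H; apply: nJ => i; apply: contrapT => /negP ?; apply: H;
      exists i.
  by rewrite (bigD1 (f i))//= (negPf iJ) ifT ?mul0r//; apply/fintype.existsP; exists i.
rewrite -sum1_card natr_sum big_mkcond/=.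
rewrite (eq_bigr (fun f : {ffun _ -> _} => (is_surj f)%:R)); last first.
  by move=> f _; rewrite inE; case: is_surj.
under eq_bigr do rewrite ind.
rewrite exchange_big/=.
under eq_bigr => J _ do rewrite -big_mkcond sumr_const card_ffun_on card_ord.
have cell_le (J : {set 'I_m}) : (#|J| < m.+1)%N.
  by rewrite ltnS (leq_trans (max_card _))// card_ord.
rewrite (partition_big (fun J : {set 'I_m} => inord #|J| : 'I_m.+1) predT)//=.
apply: eq_bigr => j _.
rewrite (eq_bigr (fun=> (-1) ^+ (m - j) * j%:R ^+ n)) => [|J /eqP <-].
  rewrite sumr_const; set N := #|_|.
  have -> : N = 'C(m, j).
    have := card_draws 'I_m j; rewrite card_ord => <-.
    rewrite /N; apply: eq_card => J; rewrite inE unfold_in.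
    by rewrite -[LHS]/(nat_of_ord (inord #|J| : 'I_m.+1) == j :> nat) inordK.
  by rewrite -mulr_natr; ring.
by rewrite inordK// -natrX mulr_natr.
Qed.

(** Composing with a transposition of the target shows that the value at [i0] is equidistributed. *)
Lemma card_surj_pointed n m (i0 : 'I_n) (c0 : 'I_m) :
  (m * #|[pred f : {ffun 'I_n -> 'I_m} | is_surj f && (f i0 == c0)]| =
   #|[pred f : {ffun 'I_n -> 'I_m} | is_surj f]|)%N.
Proof.
rewrite -[RHS]sum1_card (partition_big (fun f : {ffun 'I_n -> 'I_m} => f i0) predT)//=.
rewrite (eq_bigr (fun=> #|[pred f : {ffun 'I_n -> 'I_m} | is_surj f && (f i0 == c0)]|)).
  by rewrite sum_nat_const card_ord.
move=> c _.
pose sw (f : {ffun 'I_n -> 'I_m}) := [ffun i => tperm c c0 (f i)].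
have swK : involutive sw by move=> f; apply/ffunP => i; rewrite !ffunE tpermK.
have sws (f : {ffun 'I_n -> 'I_m}) : is_surj f -> is_surj (sw f).
  move=> /fintype.forallP fs; apply/fintype.forallP => b;
    have /fintype.existsP[i /eqP e] := fs (tperm c c0 b).
  by apply/fintype.existsP; exists i; rewrite ffunE e tpermK.
rewrite sum1_card -(card_imset _ (inv_inj swK)); apply: eq_card => f.
rewrite inE; apply/imsetP/andP => [[g]|[]].
  rewrite unfold_in => /andP[gs /eqP gi] ->.
  by rewrite (sws _ gs) ffunE gi tpermL.
move=> fs /eqP fi; exists (sw f); last by rewrite swK.
by rewrite unfold_in ffunE fi tpermR eqxx andbT; exact: sws.
Qed.

(** * Stirling numbers of the second kind *)

Lemma stirling2_rec n m :
  stirling2 n.+1 m.+1 = m.+1%:R * stirling2 n m.+1 + stirling2 n m.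
Proof.
have fn (j : nat) : j`!%:R != 0 :> rat by rewrite pnatr_eq0 -lt0n fact_gt0.
rewrite /stirling2.
have -> : \sum_(1 <= j < m.+2) (-1) ^+ (m.+1 - j) * 'C(m.+1, j)%:R * j%:R ^+ n.+1 =
   m.+1%:R * (\sum_(1 <= j < m.+2) (-1) ^+ (m.+1 - j) * 'C(m.+1, j)%:R * j%:R ^+ n
     + \sum_(1 <= j < m.+1) (-1) ^+ (m - j) * 'C(m, j)%:R * j%:R ^+ n) :> rat.
  have -> : \sum_(1 <= j < m.+1) (-1) ^+ (m - j) * 'C(m, j)%:R * j%:R ^+ n =
       \sum_(1 <= j < m.+2) (-1) ^+ (m - j) * 'C(m, j)%:R * j%:R ^+ n :> rat.
    by rewrite [RHS]big_nat_recr//= bin_small// mulr0 mul0r addr0.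
  rewrite -big_split big_distrr /=; apply: eq_big_nat => -[//|j] /andP[_ jm].
  have [jm'|jm'] := leqP j.+1 m; last first.
    have -> : j = m by lia.
    by rewrite binn bin_small// mulr0 mul0r addr0 exprS; ring.
  rewrite subSn// !exprS.
  have : (m.+1%:R * 'C(m, j)%:R = j.+1%:R * 'C(m.+1, j.+1)%:R :> rat).
    by rewrite -!natrM mul_bin_diag.
  rewrite binS natrD => e.
  rewrite [LHS](_ : _ = - (-1) ^+ (m - j.+1) * j.+1%:R ^+ n * (j.+1%:R * ('C(m,
    j.+1)%:R + 'C(m, j)%:R))); last by ring.
  by rewrite -e; ring.
rewrite factS natrM; field.
by rewrite fn nat1r pnatr_eq0.
Qed.

(** Base of the recurrence. The sum defining [stirling2] starts at j = 1, so for n = 0 it lacks the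
    j = 0 term and is not S(0, m). In the recurrence for n = 1 the two deviations cancel. *)
Lemma stirling2_1 m : stirling2 1 m.+1 = (m == 0%N)%:R.
Proof.
have U0 (i : nat) : \sum_(1 <= j < i.+1) (-1) ^+ (i - j) * 'C(i, j)%:R * j%:R ^+ 0 =
    (i == 0%N)%:R - (-1) ^+ i :> rat.
  apply/eqP; rewrite eq_sym subr_eq eq_sym; apply/eqP.
  transitivity ((-1 + 1) ^+ i : rat); last by rewrite addNr expr0n.
  rewrite exprDn big_ord_recl/= subn0 bin0 expr0 mulr1 addrC; congr (_ + _).
  rewrite big_add1/= big_mkord; apply: eq_bigr => j _.
  by rewrite /bump leq0n add1n expr1n expr0; rewrite -mulr_natr; ring.
rewrite stirling2_rec /stirling2 !U0 factS exprS natrM.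
have fn : m`!%:R != 0 :> rat by rewrite pnatr_eq0 -lt0n fact_gt0.
case: m fn => [|m] fn /=; first by rewrite invr1 ?mulr1; ring.
by field; rewrite fn -[_ + m%:R]natrD pnatr_eq0.
Qed.

Lemma stirling2_gt n m : (n < m)%N -> stirling2 n.+1 m.+1 = 0.
Proof.
elim: n m => [|n IH] [//|m] nm; first by rewrite stirling2_1.
by rewrite stirling2_rec !IH ?mulr0 ?addr0//; lia.
Qed.

Lemma stirling2_diag n : stirling2 n.+1 n.+1 = 1.
Proof.
elim: n => [|n IH]; first by rewrite stirling2_1.
by rewrite stirling2_rec IH stirling2_gt// mulr0 add0r.
Qed.

Lemma stirling2_1r n : stirling2 n 1 = 1.
Proof. by rewrite /stirling2 big_nat1 /= invr1 expr1n. Qed.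

Lemma stirling2_subdiag n : stirling2 n.+2 n.+1 = 'C(n.+2, 2)%:R.
Proof.
elim: n => [|n IH].
  by rewrite stirling2_1r.
rewrite stirling2_rec IH stirling2_diag (binS n.+2 1) bin1 natrD; ring.
Qed.

(** Prescribing one value divides (m+1)! S(n, m+1) by m+1, whence the factor i! of the f-vector. The
    point [i0] forces n > 0, so the j = 0 term of the count vanishes. *)
Lemma card_surj_stirling n m (i0 : 'I_n) (c0 : 'I_m.+1) :
  #|[pred f : {ffun 'I_n -> 'I_m.+1} | is_surj f && (f i0 == c0)]|%:R =
  m`!%:R * stirling2 n m.+1.
Proof.
have fn (j : nat) : j`!%:R != 0 :> rat by rewrite pnatr_eq0 -lt0n fact_gt0.
apply: (@mulfI _ m.+1%:R); first by rewrite pnatr_eq0.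
rewrite -natrM card_surj_pointed card_surj mulrA -natrM -factS /stirling2 mulVKf//.
rewrite big_ord_recl big_add1/= big_mkord expr0n.
rewrite (_ : n == 0%N = false) ?mulr0 ?add0r//.
by case: n i0 => // -[].
Qed.

(** * Cells and their vertices *)

Lemma rowvD (K : nmodType) n (x y : 'rV[K]_n) i : (x + y) 0 i = x 0 i + y 0 i.
Proof. by rewrite mxE. Qed.

Lemma rowvN (K : zmodType) n (x : 'rV[K]_n) i : (- x) 0 i = - x 0 i.
Proof. by rewrite mxE. Qed.

Lemma rowvZ (K : pzRingType) n (t : K) (x : 'rV[K]_n) i : (t *: x) 0 i = t * x 0 i.
Proof. by rewrite mxE. Qed.

Definition rowvE := (rowvD, rowvN, rowvZ).

Section Cells.
Variables (R : realType) (d : nat).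
Notation vec := 'rV[R]_d.+1.
Notation I := 'I_d.+1.
Implicit Types (x y z u v w : vec) (a b c : 'rV[int]_d.+1) (i j : I).

(** The representative in [V] of a vector modulo constants; locked so that simplification does not
    expose the mean. *)
Definition vproj x : vec := locked (x - const_mx ((\sum_i x 0 i) / d.+1%:R)).

Lemma vprojE x i : vproj x 0 i = x 0 i - (\sum_i x 0 i) / d.+1%:R.
Proof. by rewrite /vproj -lock !mxE. Qed.

Lemma vproj_diff x i j : vproj x 0 j - vproj x 0 i = x 0 j - x 0 i.
Proof. by rewrite !vprojE; ring. Qed.

Lemma vproj_V x : hyperplane_V (vproj x).
Proof.
rewrite /hyperplane_V /=; under eq_bigr do rewrite vprojE.
rewrite big_split /= sumr_const card_ord mulNrn -[_ / _ *+ _]mulr_natr.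
by rewrite mulfVK ?subrr// pnatr_eq0.
Qed.

Lemma vprojD x y : vproj (x + y) = vproj x + vproj y.
Proof.
apply/rowP => i; rewrite mxE !vprojE !mxE; under eq_bigr do rewrite mxE.
by rewrite big_split /= mulrDl; ring.
Qed.

Lemma vprojZ t x : vproj (t *: x) = t *: vproj x.
Proof.
apply/rowP => i; rewrite mxE !vprojE !mxE; under eq_bigr do rewrite mxE.
by rewrite -mulr_sumr; ring.
Qed.

Lemma vproj_id x : hyperplane_V x -> vproj x = x.
Proof. by move=> Vx; apply/rowP => i; rewrite vprojE Vx mul0r subr0. Qed.

Lemma vproj_const t : vproj (const_mx t) = 0.
Proof.
apply/rowP => i; rewrite vprojE !mxE; under eq_bigr do rewrite mxE.
by rewrite sumr_const card_ord -[t *+ _]mulr_natr mulfK ?subrr// pnatr_eq0.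
Qed.

Lemma vproj_eq x y : (forall i j, x 0 j - x 0 i = y 0 j - y 0 i) -> vproj x = vproj y.
Proof.
move=> xy; have -> : x = y + const_mx (x 0 ord0 - y 0 ord0).
  by apply/rowP => i; rewrite !mxE; have := xy ord0 i; lra.
by rewrite vprojD vproj_const addr0.
Qed.

Lemma V_ext x y : hyperplane_V x -> hyperplane_V y ->
  (forall i j, x 0 j - x 0 i = y 0 j - y 0 i) -> x = y.
Proof. by move=> Vx Vy xy; rewrite -(vproj_id Vx) -(vproj_id Vy); exact: vproj_eq. Qed.

Lemma VD x y : hyperplane_V x -> hyperplane_V y -> hyperplane_V (x + y).
Proof. by move=> Vx Vy; rewrite -(vproj_id Vx) -(vproj_id Vy) -vprojD;
  exact: vproj_V. Qed.

Lemma VZ t x : hyperplane_V x -> hyperplane_V (t *: x).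
Proof. by move=> Vx; rewrite -(vproj_id Vx) -vprojZ; exact: vproj_V. Qed.

Lemma VB x y : hyperplane_V x -> hyperplane_V y -> hyperplane_V (x - y).
Proof. by move=> Vx Vy; rewrite -scaleN1r; apply: VD => //; exact: VZ. Qed.

Definition int_pt a : vec := vproj (map_mx intr a).

Lemma int_pt_diff a i j : int_pt a 0 j - int_pt a 0 i = (a 0 j - a 0 i)%:~R.
Proof. by rewrite vproj_diff !mxE rmorphB. Qed.

Lemma int_pt_V a : hyperplane_V (int_pt a).
Proof. exact: vproj_V. Qed.

Lemma int_ptD a b : int_pt (a + b) = int_pt a + int_pt b.
Proof. by rewrite /int_pt map_mxD vprojD. Qed.

Lemma int_ptB a b : int_pt (a - b) = int_pt a - int_pt b.
Proof. by rewrite /int_pt map_mxB -scaleN1r vprojD vprojZ scaleN1r. Qed.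

Lemma int_pt_const (t : int) : int_pt (const_mx t) = 0.
Proof. by rewrite /int_pt map_const_mx vproj_const. Qed.

Lemma int_pt_eq a b : int_pt a = int_pt b -> exists t, a = b + const_mx t.
Proof.
move=> e; exists (a 0 ord0 - b 0 ord0); apply/rowP => i; rewrite !mxE.
have : (a 0 i - a 0 ord0)%:~R = (b 0 i - b 0 ord0)%:~R :> R by rewrite -!int_pt_diff e.
by move/intr_inj => h; lra.
Qed.

Lemma int_pt_ext a b : (forall i j, a 0 j - a 0 i = b 0 j - b 0 i) ->
  int_pt a = int_pt b.
Proof.
by move=> ab; apply: vproj_eq => i j; rewrite !mxE -!rmorphB /= ab.
Qed.

Lemma int_pt0 : int_pt 0 = 0.
Proof.
by rewrite -[RHS](int_pt_const 0); congr int_pt; apply/rowP => i; rewrite !mxE.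
Qed.

Lemma int_ptN a : int_pt (- a) = - int_pt a.
Proof. by rewrite -[- a]add0r int_ptB int_pt0 sub0r. Qed.

(* [cell_le x y]: the closed cell of [y] contains the closed cell of [x]. *)
Definition cell_le x y := forall i j (m : int),
  y 0 j - y 0 i <= m%:~R -> x 0 j - x 0 i <= m%:~R.

Lemma cell_le_refl x : cell_le x x. Proof. by []. Qed.

Lemma cell_le_trans y x z : cell_le x y -> cell_le y z -> cell_le x z.
Proof. by move=> xy yz i j m /yz /xy. Qed.

Lemma cell_le_ext x x' y y' :
  (forall i j, x 0 j - x 0 i = x' 0 j - x' 0 i) ->
  (forall i j, y 0 j - y 0 i = y' 0 j - y' 0 i) -> cell_le x y -> cell_le x' y'.
Proof. by move=> xx yy xy i j m; rewrite -xx -yy => /xy. Qed.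

Lemma cell_le_add_int a x y : cell_le x y -> cell_le (x + int_pt a) (y + int_pt a).
Proof.
move=> xy i j m.
have e w : (w + int_pt a) 0 j - (w + int_pt a) 0 i = w 0 j - w 0 i + (a 0 j - a 0
  i)%:~R.
  by rewrite -int_pt_diff !mxE; ring.
have {}xy := xy i j (m - (a 0 j - a 0 i)); rewrite !e; move: xy; rewrite intrB => xy h.
suff : x 0 j - x 0 i <= m%:~R - (a 0 j - a 0 i)%:~R by lra.
by apply: xy; lra.
Qed.

Lemma cell_le_add_intE a x y : cell_le (x + int_pt a) (y + int_pt a) <-> cell_le x y.
Proof.
split; last exact: cell_le_add_int.
by move=> /(@cell_le_add_int (- a)); rewrite int_ptN !addrK.
Qed.

Lemma cell_le_ge x y i j (m : int) : cell_le x y ->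
  m%:~R <= y 0 j - y 0 i -> m%:~R <= x 0 j - x 0 i.
Proof. by move=> /(_ j i (- m)); rewrite rmorphN /= => h; lra. Qed.

(** Rounding down relative to a level [t]. Modulo constants the result depends on [t] only modulo 1
    and can change only where [t] meets a coordinate of [x]; the values obtained are the vertices of
    the cell of [x]. *)
Definition floor_row (t : R) x : 'rV[int]_d.+1 := \row_i Num.floor (x 0 i - t).

Lemma floor_row_le t x : cell_le (int_pt (floor_row t x)) x.
Proof.
move=> i j m xm; rewrite int_pt_diff !mxE ler_int lerBlDr addrC.
have -> : m + Num.floor (x 0 i - t) = Num.floor (x 0 i - t + m%:~R).
  by rewrite [RHS]floorDrz ?intr_int// intrKfloor addrC.
apply: le_floor; lra.
Qed.

Lemma cell_le_int_pt x a : hyperplane_V x -> cell_le x (int_pt a) -> x = int_pt a.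
Proof.
move=> Vx xa; apply: V_ext => // [|i j]; first exact: int_pt_V.
rewrite int_pt_diff; apply/eqP; rewrite eq_le.
by rewrite xa ?int_pt_diff//= (cell_le_ge xa) ?int_pt_diff.
Qed.

(** The level is the coordinate minimizing [x_i - a_i]. If some [x_j - a_j] exceeded this minimum by
    1 or more, an integer bound valid for [x] would fail for [a]. *)
Lemma cell_le_floor x a : cell_le (int_pt a) x ->
  exists i, int_pt a = int_pt (floor_row (x 0 i) x).
Proof.
move=> ax; pose i := [arg min_(i < ord0) (x 0 i - (a 0 i)%:~R)]%O; exists i.
have imin j : x 0 i - (a 0 i)%:~R <= x 0 j - (a 0 j)%:~R.
  by rewrite /i; case: arg_minP => // l _ /(_ j isT).
have fE j : Num.floor (x 0 j - x 0 i) = a 0 j - a 0 i.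
  apply: floor_def; rewrite !intrD rmorphN /=; apply/andP; split.
    by have := imin j; lra.
  rewrite ltNge; apply/negP => h.
  suff : a 0 i - a 0 j <= a 0 i - a 0 j - 1 by lia.
  rewrite -(ler_int R) -int_pt_diff; apply: ax.
  by rewrite !intrB; lra.
by apply: int_pt_ext => k l; rewrite !mxE !fE; ring.
Qed.

(** Hence a cell has as many vertices as its point has distinct fractional parts of coordinates. *)
Lemma floor_row_eq x i j : int_pt (floor_row (x 0 i) x) = int_pt (floor_row (x 0 j)
  x) <->
  exists m : int, x 0 j - x 0 i = m%:~R.
Proof.
split.
  move=> e.
  have : (floor_row (x 0 i) x 0 i - floor_row (x 0 i) x 0 j)%:~R = (floor_row (x 0 j)
    x 0 i - floor_row (x 0 j) x 0 j)%:~R :> R.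
    by rewrite -!int_pt_diff e.
  rewrite !mxE !subrr floor0 sub0r subr0 => /intr_inj ee.
  exists (Num.floor (x 0 j - x 0 i)); apply/eqP; rewrite eq_le floor_le andbT.
  have := floor_le (x 0 i - x 0 j); rewrite -ee rmorphN /=; lra.
move=> [m xm]; apply: int_pt_ext => k l; rewrite !mxE.
have e q : Num.floor (x 0 q - x 0 i) = Num.floor (x 0 q - x 0 j) + m.
  rewrite (_ : x 0 q - x 0 i = x 0 q - x 0 j + m%:~R); last by rewrite -xm; ring.
  by rewrite floorDrz ?intr_int// intrKfloor.
by rewrite !e; ring.
Qed.

Definition cell_verts x : seq vec := undup [seq int_pt (floor_row (x 0 i) x) | i <-
  enum I].

Lemma mem_cell_verts x v : v \in cell_verts x <->
  (exists a, v = int_pt a) /\ cell_le v x.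
Proof.
rewrite mem_undup; split.
  by move=> /mapP[i _ ->]; split; [eexists|exact: floor_row_le].
move=> [[a ->]] /cell_le_floor[i ->]; apply/mapP; exists i => //.
by rewrite mem_enum.
Qed.

Lemma cell_verts_uniq x : uniq (cell_verts x). Proof. exact: undup_uniq. Qed.

Lemma cell_verts_size x : (size (cell_verts x) <= d.+1)%N.
Proof. by rewrite (leq_trans (size_undup _))// size_map size_enum_ord. Qed.

Lemma cell_verts_gt0 x : (0 < size (cell_verts x))%N.
Proof.
have : int_pt (floor_row 0 x) \in cell_verts x by apply/mem_cell_verts; split;
  [eexists|exact: floor_row_le].
by case: (cell_verts x).
Qed.

(** The difference [x_j - x_i] rounded up is attained at the vertex cut at level [x_j], so the
    vertices determine every inequality of the cell. *)
Lemma cell_le_verts x y : cell_le x y <-> {subset cell_verts x <= cell_verts y}.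
Proof.
split=> [xy v /mem_cell_verts[va vx]|xy i j m yxm].
  by apply/mem_cell_verts; split => //; exact: cell_le_trans xy.
have /xy/mem_cell_verts[_] : int_pt (floor_row (x 0 j) x) \in cell_verts x.
  by apply/mem_cell_verts; split; [eexists|exact: floor_row_le].
move=> /(_ i j m yxm); rewrite int_pt_diff !mxE subrr floor0 sub0r ler_int.
rewrite lerNl floor_ge_int rmorphN /=; lra.
Qed.

(** A seminorm that vanishes exactly on constants, hence a norm on [V]. The default 0 of the maximum
    is the contribution of the pairs (i, i). *)
Definition spread z : R := \big[Num.max/0]_(p : I * I) (z 0 p.2 - z 0 p.1).

Lemma spread_leP z t : reflect (0 <= t /\ forall i j,
  z 0 j - z 0 i <= t) (spread z <= t).
Proof.
apply: (iffP (bigmax_leP _ _ _ _)) => [[t0 h]|[t0 h]]; split=> //.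
by move=> i j; exact: (h (i, j)).
Qed.

Lemma spread_ltP z t : reflect (0 < t /\ forall i j, z 0 j - z 0 i < t) (spread z < t).
Proof.
apply: (iffP (bigmax_ltP _ _ _ _)) => [[t0 h]|[t0 h]]; split=> //.
by move=> i j; exact: (h (i, j)).
Qed.

Lemma le_spread z i j : z 0 j - z 0 i <= spread z.
Proof. by have /spread_leP[] := lexx (spread z). Qed.

Lemma spread_ge0 z : 0 <= spread z.
Proof. by have /spread_leP[] := lexx (spread z). Qed.

Lemma spreadD x y : spread (x + y) <= spread x + spread y.
Proof.
apply/spread_leP; split=> [|i j]; first by rewrite addr_ge0 ?spread_ge0.
by rewrite !rowvE; have := le_spread x i j; have := le_spread y i j; lra.
Qed.

Lemma spreadN x : spread (- x) = spread x.
Proof.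
have h y : spread (- y) <= spread y.
  apply/spread_leP; split=> [|i j]; first exact: spread_ge0.
  by rewrite !rowvE; have := le_spread y j i; lra.
by apply/eqP; rewrite eq_le h -{1}[x]opprK h.
Qed.

Lemma spread_eq0 x : hyperplane_V x -> spread x = 0 -> x = 0.
Proof.
move=> Vx x0; apply: V_ext => // [|i j]; first by rewrite -(vproj_const 0);
  exact: vproj_V.
by have := le_spread x i j; have := le_spread x j i; rewrite x0 !mxE; lra.
Qed.

(** The open star of a vertex is its open unit ball for [spread]: the differences of [a] are
    integers, so violating a bound means violating it by at least 1. *)
Lemma cell_leP a x : cell_le (int_pt a) x <-> spread (x - int_pt a) < 1.
Proof.
split.
  move=> ax; apply/spread_ltP; split=> // i j; rewrite ltNge; apply/negP.
  rewrite !rowvE => h.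
  have /(cell_le_ge ax) : (a 0 j - a 0 i + 1)%:~R <= x 0 j - x 0 i.
    by rewrite intrD -int_pt_diff; lra.
  by rewrite int_pt_diff ler_int; lia.
move=> /spread_ltP[_ h] i j m xm; rewrite int_pt_diff ler_int -ltzD1 -(ltr_int R).
by rewrite [ltRHS]intrD -int_pt_diff; have := h j i; rewrite !rowvE; lra.
Qed.

(** Both vertices are within distance less than 1 of [x], so their integer differences are less than
    2. *)
Lemma adjacent_verts a b x : cell_le (int_pt a) x -> cell_le (int_pt b) x ->
  spread (int_pt a - int_pt b) <= 1.
Proof.
move=> /cell_leP /spread_ltP[_ ax] /cell_leP/spread_ltP[_ bx].
apply/spread_leP; split=> // i j; rewrite -int_ptB int_pt_diff.
rewrite -[1]/(1%:~R) ler_int -ltzD1 -(ltr_int R) -int_pt_diff int_ptB intrD.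
by have := ax j i; have := bx i j; rewrite !rowvE; lra.
Qed.

Definition hat u x : R := Num.max 0 (1 - spread (x - u)).

Lemma hat_ge0 u x : 0 <= hat u x.
Proof. by rewrite le_max lexx. Qed.

Lemma hat_gt0P a x : cell_le (int_pt a) x <-> 0 < hat (int_pt a) x.
Proof. by rewrite cell_leP /hat lt_max ltxx subr_gt0. Qed.

Lemma hat_notin x a : int_pt a \notin cell_verts x -> hat (int_pt a) x = 0.
Proof.
move=> h; apply/eqP; rewrite eq_le hat_ge0 andbT leNgt; apply: contra h => h.
by apply/mem_cell_verts; split; [eexists|exact/hat_gt0P].
Qed.

Lemma hat_lip u x y : hat u x <= hat u y + spread (x - y).
Proof.
rewrite {1}/hat ge_max addr_ge0 ?hat_ge0 ?spread_ge0//=.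
have : 1 - spread (y - u) <= hat u y by rewrite le_max lexx orbT.
have := spreadD (y - x) (x - u); rewrite addrA subrK -(spreadN (y - x)) opprB; lra.
Qed.

(* An extremal pair of coordinates of [x - u] is extremal for every other
   vertex of the cell of [x], because all differences are integers. *)
Lemma vert_extremal x u : u \in cell_verts x -> exists i j,
  forall v, v \in cell_verts x -> v != u -> 1 <= (v - u) 0 i - (v - u) 0 j.
Proof.
move=> ux; have /mem_cell_verts[[a ua] _] := ux.
pose z := x - u.
pose i := [arg max_(i > ord0) z 0 i]%O; pose j := [arg min_(i < ord0) z 0 i]%O.
have imax l : z 0 l <= z 0 i by rewrite /i; case: arg_maxP => // l' _ /(_ l isT).
have jmin l : z 0 j <= z 0 l by rewrite /j; case: arg_minP => // l' _ /(_ l isT).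
exists i, j => v vx vu; have /mem_cell_verts[[b vb] bx] := vx.
(* [b - a] is weakly increasing as a function of [z]: [x] is in the star of [b], so an integer
   decrease of [b - a] forces a strict decrease of [z]. Its extremes therefore occur at [i] and
   [j]. *)
have cz k l : (b - a) 0 k - (b - a) 0 l <= 0 \/ z 0 l < z 0 k.
  case: (leP (z 0 k) (z 0 l)) => [h|]; [left|by right].
  move: bx; rewrite vb => /cell_leP/spread_ltP[_ /(_ k l)] h2.
  rewrite -ltzD1 -(ltr_int R) intrD -int_pt_diff int_ptB; move: h2 h.
  by rewrite /z ua !rowvE; lra.
have [k [l kl]] : exists k l, 1 <= (b - a) 0 k - (b - a) 0 l.
  apply: contrapT => H; move/eqP: vu; apply.
  rewrite vb ua; apply: V_ext; [exact: int_pt_V|exact: int_pt_V|move=> k l].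
  rewrite !int_pt_diff; congr (_%:~R).
  have h k' l' : (b - a) 0 k' - (b - a) 0 l' <= 0.
    by rewrite leNgt; apply/negP => h; apply: H; exists k', l'; lia.
  have := h k l; have := h l k; rewrite !rowvE.
  by move: (a 0 k) (a 0 l) (b 0 k) (b 0 l); clear; lia.
have h1 : (b - a) 0 k - (b - a) 0 i <= 0.
  by case: (cz k i) => // h; have := imax k; rewrite leNgt h.
have h2 : (b - a) 0 j - (b - a) 0 l <= 0.
  by case: (cz j l) => // h; have := jmin l; rewrite leNgt h.
rewrite vb ua -int_ptB int_pt_diff -[1]/(1%:~R) ler_int.
move: kl h1 h2; move: ((b - a) 0 i) ((b - a) 0 j) ((b - a) 0 k) ((b - a) 0 l).
by clear; lia.
Qed.

Lemma vec_sumE (s : seq vec) (t : vec -> R) (f : vec -> vec) i :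
  (\sum_(v <- s) t v *: f v) 0 i = \sum_(v <- s) t v * f v 0 i.
Proof. by rewrite summxE; apply: eq_bigr => v _; rewrite mxE. Qed.

Lemma sum_sub_const (s : seq vec) (t : vec -> R) u :
  \sum_(v <- s) t v = 1 ->
  \sum_(v <- s) t v *: v - u = \sum_(v <- s) t v *: (v - u).
Proof.
move=> t1; under [RHS]eq_bigr do rewrite scalerBr.
by rewrite sumrB -scaler_suml t1 scale1r.
Qed.

(** [y - u] is the combination of the vectors [v - u], each of spread at most 1. By [vert_extremal]
    one pair of coordinates attains at least 1 for all of them at once, so [spread (y - u)] is
    exactly the total weight [1 - t u] of the other vertices. In particular the weights are
    determined by [y]. *)
Lemma hat_combo x (t : vec -> R) (y := \sum_(v <- cell_verts x) t v *: v) :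
  (forall v, v \in cell_verts x -> 0 <= t v) -> \sum_(v <- cell_verts x) t v = 1 ->
  forall a, hat (int_pt a) y = if int_pt a \in cell_verts x then t (int_pt a) else 0.
Proof.
move=> t0 t1 a.
have dE u i j : (y - u) 0 j - (y - u) 0 i =
    \sum_(v <- cell_verts x) t v * ((v - u) 0 j - (v - u) 0 i).
  rewrite /y sum_sub_const// !vec_sumE -sumrB.
  by apply: eq_bigr => v _; rewrite mulrBr.
have yx : cell_le y x.
  move=> i j m xm; have := dE 0 i j; rewrite subr0 => ->.
  rewrite -[leRHS]mul1r -[X in X * _]t1 mulr_suml big_seq [leRHS]big_seq.
  apply: ler_sum => v vx.
  by rewrite ler_wpM2l ?t0// subr0; have /mem_cell_verts[_] := vx; apply.
case: ifPn => ax; last first.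
  apply: hat_notin; apply: contra ax => /mem_cell_verts[_ ay].
  by apply/mem_cell_verts; split; [eexists|exact: cell_le_trans yx].
set u := int_pt a in ax *.
have tu : t u = 1 - \sum_(v <- cell_verts x | v != u) t v.
  by rewrite -t1 (bigD1_seq u)//= ?cell_verts_uniq// addrK.
have dE' i j : (y - u) 0 j - (y - u) 0 i =
    \sum_(v <- cell_verts x | v != u) t v * ((v - u) 0 j - (v - u) 0 i).
  by rewrite dE (bigD1_seq u)//= ?cell_verts_uniq// !mxE !subrr mulr0 add0r.
have sp : spread (y - u) = 1 - t u.
  rewrite tu opprB [1 + _]addrC subrK; apply/eqP; rewrite eq_le; apply/andP; split.
    apply/spread_leP; split.
      by rewrite big_seq_cond sumr_ge0// => v /andP[vx _]; exact: t0.
    move=> i j; rewrite dE' big_seq_cond [leRHS]big_seq_cond.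
    apply: ler_sum => v /andP[vx vu]; rewrite -[leRHS]mulr1 ler_wpM2l ?t0//.
    have /mem_cell_verts[[b vb] bx] := vx; have /mem_cell_verts[_ ax'] := ax.
    by move: bx; rewrite vb => /adjacent_verts/(_ ax'); apply: le_trans;
      exact: le_spread.
  have [i [j ij]] := vert_extremal ax.
  apply: le_trans (le_spread _ j i); rewrite dE' big_seq_cond [leRHS]big_seq_cond.
  apply: ler_sum => v /andP[vx vu]; rewrite -[leLHS]mulr1 ler_wpM2l ?t0//.
  exact: ij.
by rewrite /hat sp opprB addrC subrK; apply/max_idPr; exact: t0.
Qed.

(* Moving [x] away from the vertex [v] until it leaves the star of [v]. *)
Lemma push_away x v (s := spread (x - v)) (y := v + s^-1 *: (x - v)) :
  v \in cell_verts x -> 0 < s -> cell_le y x /\ v \notin cell_verts y.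
Proof.
move=> vx s0; have /mem_cell_verts[[a va] ax] := vx.
have s1 : s < 1 by rewrite /s va; apply/cell_leP; rewrite -va.
have ydiff i j : (y - v) 0 j - (y - v) 0 i = s^-1 * ((x - v) 0 j - (x - v) 0 i).
  by rewrite /y addrAC subrr add0r !rowvE; ring.
split.
  suff : cell_le (y - v) (x - v).
    by move=> /(@cell_le_add_int a); rewrite -va !subrK.
  move=> i j m; rewrite ydiff => xm.
  have zs := le_spread (x - v) i j; have zs' := le_spread (x - v) j i.
  rewrite -/s in zs zs'.
  rewrite mulrC ler_pdivrMr//.
  (* After scaling, differences have absolute value at most 1. A bound m at least 1 then holds
     automatically, the bound 0 is invariant under scaling, and a bound at most -1 never holds for
     [x - v], because s < 1. *)
  have [m1|] := leP 1 m.
    have : 1 <= m%:~R :> R by rewrite -[1]/(1%:~R) ler_int.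
    by move=> m1'; apply: le_trans zs _; rewrite ler_peMl// ltW.
  rewrite -[X in m < X]add0r ltzD1 le_eqVlt => /predU1P[m0|m0].
    by rewrite m0 mul0r; rewrite m0 in xm.
  have : m%:~R <= -1 :> R by rewrite -[-1]/((-1)%:~R) ler_int; lia.
  by move=> ?; exfalso; lra.
apply/negP => /mem_cell_verts[_]; rewrite va => /cell_leP /spread_ltP[_];
  rewrite -va => h.
have [i [j ij]] : exists i j, s <= (x - v) 0 j - (x - v) 0 i.
  apply: contrapT => H; suff : s < s by rewrite ltxx.
  apply/spread_ltP; split=> // i j; rewrite ltNge; apply/negP => ?.
  by apply: H; exists i, j.
have := h i j; rewrite ydiff mulrC ltr_pdivrMr// mul1r ltNge; by rewrite ij.
Qed.

(** Induction on the number of vertices: pushing [x] away from a vertex [v] lands at a point [y] of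
    a smaller face, which does not have [v] as a vertex. *)
Lemma cell_verts_combo x : hyperplane_V x -> exists t : vec -> R,
  [/\ forall v, 0 <= t v, \sum_(v <- cell_verts x) t v = 1
    & x = \sum_(v <- cell_verts x) t v *: v].
Proof.
have [m] := ubnP (size (cell_verts x)); elim: m => // m IH in x *;
  rewrite ltnS => xm Vx.
pose v := int_pt (floor_row 0 x).
have vx : v \in cell_verts x by apply/mem_cell_verts; split;
  [eexists|exact: floor_row_le].
have Vv : hyperplane_V v := int_pt_V _.
have [s0|s0] := leP (spread (x - v)) 0.
  have xv : x = v.
    apply/eqP; rewrite -subr_eq0; apply/eqP; apply: spread_eq0; first exact: VB.
    by apply/eqP; rewrite eq_le s0 spread_ge0.
  exists (fun w => (w == v)%:R); split => [w||]; first by rewrite ler0n.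
    rewrite (bigD1_seq v)//= ?cell_verts_uniq// eqxx big1 ?addr0//.
    by move=> w /negPf ->.
  rewrite (bigD1_seq v)//= ?cell_verts_uniq// eqxx big1 ?addr0 ?scale1r//.
  by move=> w /negPf ->; rewrite scale0r.
set s := spread (x - v) in s0.
have [yx vy] := push_away vx s0; rewrite -/s in yx vy.
set y := (v + _) in yx vy.
have s1 : s < 1 by apply/cell_leP; have /mem_cell_verts[] := vx.
have Vy : hyperplane_V y by apply: VD => //; apply: VZ; exact: VB.
have /cell_le_verts sub := yx.
have szy : (size (cell_verts y) < m)%N.
  apply: leq_trans xm; rewrite -[X in (X <= _)%N]/(size (v :: cell_verts y)).
  apply: uniq_leq_size; first by rewrite /= vy cell_verts_uniq.
  by move=> w; rewrite inE => /predU1P[->//|]; exact: sub.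
have [t [t0 t1 yE]] := IH _ szy Vy.
have sumE (V : lmodType R) (F : vec -> V) :
    \sum_(w <- cell_verts x) (if w \in cell_verts y then F w else 0) = \sum_(w <-
      cell_verts y) F w.
  rewrite -big_mkcond -big_filter; apply: perm_big; apply: uniq_perm.
  - by rewrite filter_uniq// cell_verts_uniq.
  - exact: cell_verts_uniq.
  - by move=> w; rewrite mem_filter; case: (boolP (w \in cell_verts y)) => // /sub ->.
(* By the choice of [y], [x = (1 - s) v + s y]. *)
exists (fun w => (w == v)%:R * (1 - s) + s * (if w \in cell_verts y then t w else
  0)); split.
- move=> w; apply: addr_ge0; apply: mulr_ge0;
    rewrite ?ler0n ?subr_ge0 ?(ltW s0) ?(ltW s1)//.
  by case: ifP.
- rewrite big_split /= -mulr_sumr (sumE R^o) t1 mulr1 (bigD1_seq v)//=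
  ?cell_verts_uniq//.
  rewrite eqxx mul1r big1 ?addr0 ?subrK// => w /negPf ->; by rewrite mul0r.
- under eq_bigr do rewrite scalerDl.
  rewrite big_split /= (bigD1_seq v)//= ?cell_verts_uniq// eqxx mul1r big1; last first.
    by move=> w /negPf ->; rewrite mul0r scale0r.
  have -> : \sum_(w <- cell_verts x) (s * (if w \in cell_verts y then t w else 0)) *:
    w =
     s *: \sum_(w <- cell_verts x) (if w \in cell_verts y then t w *: w else 0).
    by rewrite scaler_sumr; apply: eq_bigr => w _; case: ifP;
      rewrite ?mulr0 ?scale0r ?scaler0 ?scalerA.
  rewrite sumE -yE /y addr0 scalerDr scalerA divff ?gt_eqF// scale1r scalerBl scale1r.
  by rewrite addrA subrK addrC subrK.
Qed.

Lemma hat_sum x : hyperplane_V x -> \sum_(v <- cell_verts x) hat v x = 1.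
Proof.
move=> /cell_verts_combo[t [t0 t1 xE]]; rewrite -[RHS]t1 big_seq [RHS]big_seq.
apply: eq_bigr => v vx; have /mem_cell_verts[[a va] _] := vx.
by rewrite {1}xE va hat_combo// -va vx.
Qed.

Lemma hat_decomp x : hyperplane_V x -> x = \sum_(v <- cell_verts x) hat v x *: v.
Proof.
move=> /cell_verts_combo[t [t0 t1 xE]]; rewrite {1}xE big_seq [RHS]big_seq.
apply: eq_bigr => v vx; have /mem_cell_verts[[a va] _] := vx; congr (_ *: _).
by rewrite [in RHS]xE va hat_combo// -va vx.
Qed.

End Cells.

(** * The quotient complex *)

Section ClosedCells.
Variables (R : realType) (d : nat).
Notation vec := 'rV[R]_d.+1.
Implicit Types (x y z u v w : vec) (a b c : 'rV[int]_d.+1) (i j : 'I_d.+1).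

Definition cell x : set vec := [set y | hyperplane_V y /\ cell_le y x].

Lemma open_cell_le x y : open_cell x y -> cell_le y x.
Proof.
move=> [_ sg] i j m xm; case: (ltngtP i j) => [ij|ji|/val_inj ij].
- by rewrite -subr_le0 -sgr_le0 sg// sgr_le0 subr_le0.
- have := sg j i (- m) ji; rewrite rmorphN opprK => e.
  have : 0 <= y 0 i - y 0 j + m%:~R by rewrite -sgr_ge0 e sgr_ge0; lra.
  lra.
- by move: xm; rewrite ij !subrr.
Qed.

(** Against each hyperplane, [y] lies on the same closed side as [x], and on the hyperplane if [x]
    does. Any positive weight on [x] thus gives the sign of [x]. *)
Lemma cell_le_open_cell x y (t : R) : hyperplane_V x ->
  hyperplane_V y -> cell_le y x ->
  0 < t -> t <= 1 -> open_cell x (y + t *: (x - y)).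
Proof.
move=> Vx Vy yx t0 t1; split; first by apply: VD => //; apply: VZ; exact: VB.
move=> i j m _; rewrite !rowvE.
have h1 := yx i j m; have h2 := @cell_le_ge _ _ y x i j m yx.
have e : y 0 j + t * (x 0 j - y 0 j) - (y 0 i + t * (x 0 i - y 0 i)) - m%:~R =
  (1 - t) * (y 0 j - y 0 i - m%:~R) + t * (x 0 j - x 0 i - m%:~R) by ring.
rewrite e; set X := x 0 j - _ - _ in e *; set Y := y 0 j - _ - _ in e *.
have XY : X <= 0 -> Y <= 0 by rewrite /X /Y !subr_le0.
have XY' : 0 <= X -> 0 <= Y by rewrite /X /Y !subr_ge0.
have t1' : 0 <= 1 - t by rewrite subr_ge0.
case: (ltrgtP X 0) => X0.
- rewrite !ltr0_sg//; have : (1 - t) * Y <= 0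
  by rewrite (mulr_ge0_le0 t1' (XY (ltW X0))).
  have : t * X < 0 by rewrite pmulr_rlt0.
  by lra.
- rewrite !gtr0_sg//; have : 0 <= (1 - t) * Y by rewrite (mulr_ge0 t1' (XY' (ltW X0))).
  have : 0 < t * X by rewrite pmulr_rgt0.
  by lra.
- have -> : Y = 0 by apply/eqP; rewrite eq_le XY ?XY' ?X0.
  by rewrite X0 !mulr0 addr0.
Qed.

Lemma closure_open_cell x : hyperplane_V x -> closure (open_cell x) = cell x.
Proof.
move=> Vx; apply/seteqP; split => [y cy|y [Vy yx] B].
  have app (e : R) : 0 < e -> exists2 z, open_cell x z & forall i, `|y 0 i - z 0 i| < e.
    move=> e0; have [z [oz bz]] := cy _ (nbhsx_ballx y e e0).
    by exists z => // i; have [_ yz] := bz; exact: (yz 0 i).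
  split.
    rewrite /hyperplane_V /=; apply/eqP; rewrite -normr_le0; apply/ler_addgt0Pr => e e0.
    have [z [Vz _] yz] := app (e / d.+1%:R) (divr_gt0 e0 (ltr0Sn _ _)).
    rewrite add0r; have -> : \sum_i y 0 i = \sum_i (y 0 i - z 0 i).
      by rewrite sumrB [X in _ - X]Vz subr0.
    apply: le_trans (ler_norm_sum _ _ _) _.
    apply: le_trans (_ : \sum_(i < d.+1) e / d.+1%:R <= _).
      by apply: ler_sum => i _; exact: ltW.
    by rewrite sumr_const card_ord -[_ *+ d.+1]mulr_natr mulfVK// pnatr_eq0.
  move=> i j m xm; apply/ler_addgt0Pr => e e0.
  have [z /open_cell_le zx yz] := app (e / 2) (divr_gt0 e0 (ltr0Sn _ _)).
  have := zx i j m xm; have := yz i; have := yz j; rewrite !ltr_norml; lra.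
move=> /nbhs_ballP[e /= e0 yeB].
have n0 : 0 < 1 + `|x - y| by rewrite ltr_wpDr.
(* Small enough to stay within [e] of [y]; the summand 1 keeps the denominator positive when
   [x = y]. *)
pose t := Num.min 1 (e / (1 + `|x - y|)).
have t0 : 0 < t by rewrite lt_min ltr01 divr_gt0.
exists (y + t *: (x - y)); split.
  by apply: cell_le_open_cell => //; rewrite ge_min lexx.
apply: yeB; rewrite -ball_normE /= opprD addrA subrr sub0r normrN normrZ gtr0_norm//.
apply: le_lt_trans (_ : e / (1 + `|x - y|) * `|x - y| < _).
  by rewrite ler_wpM2r// ge_min lexx orbT.
by rewrite mulrAC ltr_pdivrMr// ltr_pM2l// ltrDr.
Qed.

Lemma Sigma_facesP (F : set vec) :
  Sigma_faces F <-> exists2 x, hyperplane_V x & F = cell x.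
Proof.
by split=> -[x Vx ->]; exists x; rewrite // closure_open_cell.
Qed.

Lemma cell_sub x y : hyperplane_V x -> cell x `<=` cell y <-> cell_le x y.
Proof.
move=> Vx; split=> [|xy z [Vz zx]]; last by split=> //; exact: cell_le_trans xy.
by move=> /(_ x (conj Vx (cell_le_refl (x := x)))) [].
Qed.

Lemma cell_inj x y : hyperplane_V x -> hyperplane_V y ->
  cell x = cell y <-> cell_le x y /\ cell_le y x.
Proof.
move=> Vx Vy; split=> [e|[xy yx]]; last by apply/seteqP; split; apply/cell_sub.
by split; apply/cell_sub => //; rewrite e.
Qed.

Lemma translate_cell a x : translate (int_pt R a) (cell x) = cell (x + int_pt R a).
Proof.
apply/seteqP; split=> [_ [y [Vy yx] <-]|y [Vy yx]].
  by split; [apply: VD => //; exact: int_pt_V|exact: cell_le_add_int].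
exists (y - int_pt R a); last by rewrite subrK.
split; first by apply: VB => //; exact: int_pt_V.
by apply/(cell_le_add_intE a); rewrite subrK.
Qed.

(** Translates the lattice of the statement into integer vectors modulo constants, so that its
    elements become the [period b]. *)
Lemma sum_wt_vec a : \sum_i (a 0 i)%:~R *: wt_vec R i = int_pt R a.
Proof.
apply/rowP => j; rewrite summxE vprojE.
under eq_bigr => i _ do rewrite !mxE summxE.
have e : \sum_(l < d.+1) std_basis R l 0 j = 1.
  rewrite (bigD1 j)//= mxE !eqxx big1 ?addr0// => l /negPf lj.
  by rewrite mxE eqxx eq_sym lj.
under eq_bigr => i _ do rewrite e.
rewrite mxE mulr_suml -[X in X - _]mulr1 (bigD1 j)//= [X in _ - X](bigD1 j)//=.
rewrite !mxE !eqxx /= opprD addrA -sumrN; congr (_ + _).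
  by rewrite -mulrBr; congr (_ * _); rewrite mulrBr !mulr1 mulVf// pnatr_eq0.
apply: eq_bigr => i /negPf ij.
by rewrite !mxE [j == i]eq_sym ij mulr0 sub0r mulrN1 mulrN.
Qed.

Lemma V_sum (J : Type) (s : seq J) (P : pred J) (f : J -> vec) :
  (forall l, hyperplane_V (f l)) -> hyperplane_V (\sum_(i <- s | P i) f i).
Proof.
move=> Vf; apply: (big_ind (@hyperplane_V R d)) => //.
  by rewrite /hyperplane_V /= big1// => i _; rewrite mxE.
exact: VD.
Qed.

End ClosedCells.

Lemma card_fset_set_seq (T : choiceType) (s : seq T) : uniq s ->
  #|` fset_set [set` s]|%fset = size s.
Proof.
move=> us; have -> : [set` s] = [set` [fset C in s]%fset].
  by apply/seteqP; split=> C /=; rewrite !inE.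
by rewrite set_fsetK card_fseq undup_id.
Qed.

Section TkComplex.
Variables (R : realType) (d : nat) (k : 'I_d.+1 -> nat).
Hypothesis d_gt0 : (0 < d)%N.
Hypothesis k_gt0 : forall i, (0 < k i)%N.
Notation vec := 'rV[R]_d.+1.
Notation T := (Tk R k).
Notation int_pt := (@int_pt R d).
Implicit Types (x y z u v w : vec) (a b c : 'rV[int]_d.+1) (i j : 'I_d.+1).

Definition period b : vec := int_pt (b *m Mk k).

Lemma periodD b c : period (b + c) = period b + period c.
Proof. by rewrite /period mulmxDl int_ptD. Qed.

Lemma periodN b : period (- b) = - period b.
Proof. by rewrite /period mulNmx int_ptN. Qed.

Lemma period0 : period 0 = 0.
Proof. by rewrite /period mul0mx int_pt0. Qed.

Lemma period_V b : hyperplane_V (period b).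
Proof. exact: int_pt_V. Qed.

Lemma LtkP v : @Ltk R d k v <-> exists b, v = period b.
Proof. by split=> -[b vb]; exists b; rewrite vb ?sum_wt_vec// /period -sum_wt_vec. Qed.

(** By [Mk_spread], [b] is constant. The bound 2 is what the comparison of two lifts of a face
    requires: twice the maximal spread of an edge. *)
Lemma period_sparse b : spread (period b) <= 2 -> period b = 0.
Proof.
move=> /spread_leP[_ h].
have [|c bc] := @Mk_spread d k d_gt0 b k_gt0.
  by move=> i j; have := h j i; rewrite int_pt_diff -[2]/(2%:~R) ler_int.
by rewrite /period bc mul_const_Mk// int_pt_const.
Qed.

Definition cell_class x : face_type T := set_class (@Ltk R d k) (cell x).

Lemma cell_classE x : cell_class x = [set cell (x + period b) | b in setT].
Proof.
apply/seteqP; split=> [_ [v /LtkP[b ->] <-]|_ [b _ <-]].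
  by exists b => //; rewrite translate_cell.
by exists (period b); rewrite ?translate_cell//; apply/LtkP; exists b.
Qed.

Lemma in_cell_class x b : cell_class x (cell (x + period b)).
Proof. by rewrite cell_classE; exists b. Qed.

Lemma in_cell_class0 x : cell_class x (cell x).
Proof. by have := in_cell_class x 0; rewrite period0 addr0. Qed.

Lemma cell_class_period x b : cell_class (x + period b) = cell_class x.
Proof.
rewrite !cell_classE; apply/seteqP; split=> _ [c _ <-].
  by exists (b + c) => //; rewrite periodD addrA.
by exists (c - b) => //; rewrite periodD periodN [period c - _]addrC addrA addrK.
Qed.

Lemma VD_period x b : hyperplane_V x -> hyperplane_V (x + period b).
Proof. by move=> Vx; apply: VD => //; exact: period_V. Qed.

Lemma cell_class_eqP x y : hyperplane_V x -> hyperplane_V y ->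
  cell_class x = cell_class y <-> exists b,
    cell_le (x + period b) y /\ cell_le y (x + period b).
Proof.
move=> Vx Vy; split=> [e|[b /cell_inj e]].
  have := in_cell_class0 y; rewrite -e cell_classE => -[b _ /cell_inj h]; exists b;
    apply: h => //.
  exact: VD_period.
by rewrite -(cell_class_period x b) /cell_class e//; exact: VD_period.
Qed.

Lemma facesP (C : face_type T) : faces C <->
  exists2 x, hyperplane_V x & C = cell_class x.
Proof.
split=> [[F /Sigma_facesP[x Vx ->] <-]|[x Vx ->]]; first by exists x.
by exists (cell x) => //; apply/Sigma_facesP; exists x.
Qed.

Lemma faces_cell_class x : hyperplane_V x -> faces (cell_class x).
Proof. by move=> Vx; apply/facesP; exists x. Qed.

Lemma containedP x y : hyperplane_V x -> hyperplane_V y ->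
  contained (cell_class x) (cell_class y) <-> exists b, cell_le (x + period b) y.
Proof.
move=> Vx Vy; split=> [[F [G []]]|[b xy]].
  rewrite !cell_classE => -[b _ <-] [c _ <-] /cell_sub h; exists (b - c).
  have {}h := h (VD_period b Vx).
  by move: (cell_le_add_int (a := (- c) *m Mk k) h);
    rewrite -/(period _) periodD periodN addrK addrA.
exists (cell (x + period b)), (cell y); split;
  [exact: in_cell_class|exact: in_cell_class0|].
by apply/cell_sub => //; exact: VD_period.
Qed.

Lemma cell_class_vertP a b : cell_class (int_pt a) = cell_class (int_pt b) <->
  exists c, int_pt a + period c = int_pt b.
Proof.
rewrite cell_class_eqP; [|exact: int_pt_V|exact: int_pt_V].
split=> -[c]; last by move=> <-; exists c; split; exact: cell_le_refl.
by move=> [h _]; exists c; apply: cell_le_int_pt h; apply: VD_period; exact: int_pt_V.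
Qed.

Lemma verticesP (C : face_type T) : vertices C <-> exists a, C = cell_class (int_pt a).
Proof.
split=> [[/facesP[x Vx ->] h]|[a ->]].
  exists (floor_row 0 x); symmetry; apply: h; first exact/faces_cell_class/int_pt_V.
  apply/containedP => //; first exact: int_pt_V.
  by exists 0; rewrite period0 addr0; exact: floor_row_le.
split; first exact/faces_cell_class/int_pt_V.
move=> _ /facesP[y Vy ->] /containedP[]; [exact: Vy|exact: int_pt_V|].
by move=> b /(cell_le_int_pt (VD_period b Vy)) e; rewrite -(cell_class_period y b) e.
Qed.

Lemma vertices_ofE x : hyperplane_V x ->
  vertices_of (cell_class x) = [set cell_class v | v in [set` cell_verts x]].
Proof.
move=> Vx; apply/seteqP; split=> [C [/verticesP[a ->]]|_ [v /mem_cell_verts[[a ->]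
  ax] <-]].
  move=> /containedP[] //; [exact: int_pt_V|move=> b].
  rewrite /period -int_ptD => h; exists (int_pt (a + b *m Mk k)).
    by apply/mem_cell_verts; split; [eexists|].
  by rewrite int_ptD -/(period b) cell_class_period.
split; first by apply/verticesP; exists a.
apply/containedP => //; first exact: int_pt_V.
by exists 0; rewrite period0 addr0.
Qed.

Lemma cell_class_inj_star x : {in cell_verts x &, injective cell_class}.
Proof.
move=> _ _ /mem_cell_verts[[a ->] ax] /mem_cell_verts[[b ->] bx] /cell_class_vertP[c e].
have : period c = 0.
  apply: period_sparse; have -> : period c = int_pt b - int_pt a
    by rewrite -e addrAC subrr add0r.
  by apply: le_trans (adjacent_verts bx ax) _; rewrite ler1n.
by move=> c0; rewrite -e c0 addr0.
Qed.

Lemma card_vertices_of x : hyperplane_V x ->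
  finite_set (vertices_of (cell_class x)) /\
  #|` fset_set (vertices_of (cell_class x))|%fset = size (cell_verts x).
Proof.
move=> Vx; rewrite vertices_ofE//; split; first exact/finite_image/finite_seq.
have -> : [set cell_class v | v in [set` cell_verts x]] = [set` [seq cell_class v | v
  <- cell_verts x]].
  apply/seteqP; split=> C /=; first by move=> [v vx <-]; exact: map_f.
  by move=> /mapP[v vx ->]; exists v.
have -> : size (cell_verts x) = size [seq cell_class v | v <- cell_verts x]
  by rewrite size_map.
rewrite card_fset_set_seq// map_inj_in_uniq ?cell_verts_uniq//.
exact: cell_class_inj_star.
Qed.

Lemma face_dimE x : hyperplane_V x ->
  face_dim (cell_class x) = (size (cell_verts x)).-1.
Proof. by move=> /card_vertices_of[_]; rewrite /face_dim => ->. Qed.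

(** Each vertex of [x] is carried into the cell of [y] by its own period. Two of these periods
    differ by an edge vector of [y] minus an edge vector of [x], hence by a period of spread at most
    2, which is 0. *)
Lemma vertices_of_sub x y : hyperplane_V x -> hyperplane_V y ->
  (forall v, v \in cell_verts x -> exists2 w,
    w \in cell_verts y & cell_class w = cell_class v) ->
  exists b, forall v, v \in cell_verts x -> v + period b \in cell_verts y.
Proof.
move=> Vx Vy h; pose v0 := int_pt (floor_row 0 x).
have v0x : v0 \in cell_verts x by apply/mem_cell_verts; split;
  [eexists|exact: floor_row_le].
have shift v : v \in cell_verts x -> exists b, v + period b \in cell_verts y.
  move=> vx; have /mem_cell_verts[[a va] _] := vx; have [w wy] := h v vx.
  have /mem_cell_verts[[c wc] _] := wy; rewrite va wc => /esym/cell_class_vertP[b e].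
  by exists b; rewrite e -wc.
have [b v0y] := shift v0 v0x; exists b => v vx; have [c vy] := shift v vx.
suff /eqP : period (c - b) = 0 by rewrite periodD periodN subr_eq0 => /eqP <-.
apply: period_sparse; rewrite periodD periodN.
have -> : period c - period b = ((v + period c) - (v0 + period b)) - (v - v0).
  by apply/rowP => i; rewrite !rowvE; ring.
apply: le_trans (spreadD _ _) _; rewrite spreadN -[2]/(1 + 1).
have e p q z : p \in cell_verts z -> q \in cell_verts z -> spread (p - q) <= 1.
  by move=> /mem_cell_verts[[? ->] ?] /mem_cell_verts[[? ->] ?];
    exact: (@adjacent_verts _ _ _ _ z).
by apply: lerD; [exact: (e _ _ y)|exact: (e _ _ x)].
Qed.

Lemma vertices_of_le x y : hyperplane_V x -> hyperplane_V y ->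
  vertices_of (cell_class x) `<=` vertices_of (cell_class y) <->
    exists b, cell_le (x + period b) y.
Proof.
move=> Vx Vy; rewrite !vertices_ofE//; split.
  move=> h; have [|b hb] := vertices_of_sub Vx Vy.
    by move=> v vx; have [|w wy e] := h (cell_class v); [exists v|exists w].
  exists b; apply/cell_le_verts => v /mem_cell_verts[[a ->] ax].
  have := hb (int_pt (a - b *m Mk k)); rewrite int_ptB -/(period b) subrK; apply.
  apply/mem_cell_verts; split; first by exists (a - b *m Mk k); rewrite int_ptB.
  by apply/(cell_le_add_intE (b *m Mk k)); rewrite -/(period b) subrK.
move=> [b /cell_le_verts xy] _ [v vx <-]; exists (v + period b);
  last exact: cell_class_period.
apply: xy; have /mem_cell_verts[[a va] ax] := vx; apply/mem_cell_verts; split.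
  by exists (a + b *m Mk k); rewrite va int_ptD.
exact: cell_le_add_int.
Qed.

(* The barycenter of a set of vertices of the cell of [x] spans the
   corresponding face. *)
Lemma subface x (S : set vec) : (exists2 v, v \in cell_verts x & S v) ->
  exists2 y, hyperplane_V y & forall v, v \in cell_verts y <->
    v \in cell_verts x /\ S v.
Proof.
move=> [v0 v0x Sv0].
pose m := count (fun v => `[<S v>]) (cell_verts x).
have m_gt0 : 0 < m%:R^-1 :> R.
  by rewrite invr_gt0 ltr0n -has_count; apply/hasP; exists v0 => //; exact/asboolP.
pose t v : R := if `[<S v>] then m%:R^-1 else 0.
have t0 v : v \in cell_verts x -> 0 <= t v by move=> _; rewrite /t;
  case: ifP => // _; exact: ltW.
have t1 : \sum_(v <- cell_verts x) t v = 1.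
  rewrite -big_mkcond big_const_seq iter_addr addr0 -/m -[_ *+ m]mulr_natr mulVf//.
  by rewrite -invr_eq0 gt_eqF.
pose vs v : vec := if v \in cell_verts x then v else 0.
have yE : \sum_(v <- cell_verts x) t v *: v = \sum_(v <- cell_verts x) t v *: vs v.
  by rewrite big_seq [RHS]big_seq; apply: eq_bigr => v vx; rewrite /vs vx.
exists (\sum_(v <- cell_verts x) t v *: v).
  rewrite yE; apply: V_sum => v; apply: VZ; rewrite /vs; case: ifPn => [|_].
    by move=> /mem_cell_verts[[a ->] _]; exact: int_pt_V.
  by rewrite -(int_pt0 R d); exact: int_pt_V.
move=> v; split.
  move=> /mem_cell_verts[[a ->]] /hat_gt0P; rewrite hat_combo//; case: ifPn => [ax|];
    last by rewrite ltxx.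
  by rewrite /t; case: asboolP => //; rewrite ltxx.
move=> [vx Sv]; have /mem_cell_verts[[a va] _] := vx.
apply/mem_cell_verts; split; first by exists a.
by rewrite va; apply/hat_gt0P; rewrite hat_combo// -va vx /t; case: asboolP.
Qed.

Lemma Tk_simplicial : simplicial_complex T.
Proof.
have Nne x : cell_verts x != [::] by rewrite -size_eq0 -lt0n cell_verts_gt0.
split.
- move=> F /facesP[x Vx ->]; split; first by have [] := card_vertices_of Vx.
  rewrite vertices_ofE//; have := Nne x; case E: (cell_verts x) => [|v s] // _.
  by exists (cell_class v); exists v => //=; rewrite inE eqxx.
- move=> F G /facesP[x Vx ->] /facesP[y Vy ->].
  by rewrite containedP// vertices_of_le.
- move=> F G /facesP[x Vx ->] /facesP[y Vy ->] e.
  have [b xy] : exists b, cell_le (x + period b) y by apply/vertices_of_le => //;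
    rewrite e.
  have [c yx] : exists b, cell_le (y + period b) x by apply/vertices_of_le => //;
    rewrite e.
  apply/cell_class_eqP => //; exists b; split => //.
  (* Equal numbers of vertices turn the inclusion of vertex lists into an equality. *)
  apply/cell_le_verts.
  have sz : size (cell_verts x) = size (cell_verts y).
    by have [_ <-] := card_vertices_of Vx; have [_ <-] := card_vertices_of Vy;
      rewrite e.
  have szb : size (cell_verts (x + period b)) = size (cell_verts x).
    have [_ <-] := card_vertices_of (VD_period b Vx);
      have [_ <-] := card_vertices_of Vx.
    by rewrite cell_class_period.
  have /cell_le_verts sub := xy.
  have [|_ h] := uniq_min_size (cell_verts_uniq _) sub; first by rewrite szb sz.
  by move=> v; rewrite h.
- move=> F S /facesP[x Vx ->] [C SC] Ssub.
  have SE D : S D -> exists2 v, v \in cell_verts x & D = cell_class v.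
    by move=> /Ssub; rewrite vertices_ofE// => -[v vx <-]; exists v.
  have [|y Vy yE] := @subface x [set v | S (cell_class v)].
    by have [v vx e] := SE C SC; exists v => //=; rewrite -e.
  exists (cell_class y); first exact: faces_cell_class.
  rewrite vertices_ofE//; apply/seteqP; split=> [_ [v /yE[_ Sv] <-]//|D SD].
  by have [v vx e] := SE D SD; exists v => //; apply/yE; split=> //=; rewrite -e.
Qed.

End TkComplex.

(** * The geometric realization *)

Section QuotientHomeo.
Variables (X Y Z : topologicalType).

Lemma compact_quotient_continuous (K : set X) (f : X -> Y) (g : X -> Z) (h : Y -> Z) :
  compact K -> hausdorff_space Y -> continuous f -> continuous g ->
  (forall x, K x -> h (f x) = g x) -> {within f @` K, continuous h}.
Proof.
move=> cK hY cf cg hfg; apply/continuous_closedP => C clC.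
have E : (h @^-1` C) `&` (f @` K) = f @` (K `&` g @^-1` C).
  apply/seteqP; split=> [_ [/[swap] -[x Kx <-] /= hC]|_ [x [Kx gC] <-]].
    by exists x => //; split=> //=; rewrite -hfg.
  by split; [rewrite /= hfg|exists x].
apply/closed_subspaceP; exists (f @` (K `&` g @^-1` C)).
  2: by move: (congr1 (setI^~ (f @` K)) E); rewrite -setIA setIid => <-.
  apply: compact_closed => //; apply: continuous_compact.
    exact: continuous_subspaceT.
  apply: compact_closedI => //; move/continuous_closedP : cg; exact.
Qed.
End QuotientHomeo.

Lemma quotient_homeomorphic (X Y Z : topologicalType) (K : set X)
    (f : X -> Y) (g : X -> Z) (A : set Y) (B : set Z) :
  K !=set0 -> compact K -> hausdorff_space Y -> hausdorff_space Z ->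
  continuous f -> continuous g -> f @` K = A -> g @` K = B ->
  (forall x y, K x -> K y -> f x = f y <-> g x = g y) ->
  homeomorphic A B.
Proof.
move=> [x0 Kx0] cK hY hZ cf cg <- <- fg.
(* The fallback [x0] of [xget] is never reached on the images, and equality of fibres makes the
   chosen preimage irrelevant. *)
pose h y := g (xget x0 [set x | K x /\ f x = y]).
pose h' z := f (xget x0 [set x | K x /\ g x = z]).
have hf x : K x -> h (f x) = g x.
  move=> Kx; rewrite /h; case: xgetP => [x' -> [Kx' e]|/(_ x)/=[]//].
  by apply/fg.
have hg x : K x -> h' (g x) = f x.
  move=> Kx; rewrite /h'; case: xgetP => [x' -> [Kx' e]|/(_ x)/=[]//].
  by apply/fg.
exists h, h'; split.
- exact: compact_quotient_continuous hf.
- exact: compact_quotient_continuous hg.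
- by move=> _ [x Kx <-]; rewrite hf// hg//; split=> //; exists x.
- by move=> _ [x Kx <-]; rewrite hg// hf//; split=> //; exists x.
Qed.

(** * The standard torus as a quotient of the unit cube *)

Section Torus.
Variables (R : realType) (d : nat).

Definition cube : set 'rV[R]_d := [set b | forall i, `[0, 1]%classic (b ord0 i)].

Lemma cube_compact : compact cube.
Proof. by apply: (@rV_compact R d (fun=> `[0, 1]%classic)) => i;
  exact: segment_compact. Qed.

Definition wrap (b : 'rV[R]_d) : 'M[R]_(d, 2) :=
  \matrix_(i, j) if j == 0 then cos (2 * pi * b ord0 i) else sin (2 * pi * b ord0 i).

Lemma coord_continuous_row n (i : 'I_n) : continuous (fun b : 'rV[R]_n => b ord0 i).
Proof. exact: coord_continuous. Qed.

Lemma mx_continuous (X : topologicalType) m n (f : X -> 'M[R]_(m, n)) :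
  (forall i j, continuous (fun x => f x i j)) -> continuous f.
Proof.
move=> cf x; apply/cvg_ballP => e e0.
have h : \forall y \near x, forall i j, ball (f x i j) e (f y i j).
  apply: filter_forall => i; apply: filter_forall => j.
  by have /cvg_ballP := cf i j x; apply.
near=> y; split=> //; near: y; exact: h.
Unshelve. all: by end_near. Qed.

Lemma wrap_continuous : continuous wrap.
Proof.
apply: mx_continuous => i j.
have -> : (fun b => wrap b i j) =
  (if j == 0 then cos else sin) \o (fun b : 'rV[R]_d => 2 * pi * b ord0 i).
  by apply/funext => b; rewrite /= !mxE; case: ifP.
move=> b; apply: continuous_comp.
  apply: (@continuousM R _ (fun=> 2 * pi) (fun b : 'rV[R]_d => b ord0 i)).
    exact: cst_continuous.
  exact: coord_continuous_row.
by case: ifP => _; [exact: continuous_cos|exact: continuous_sin].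
Qed.

(** For [t] in [0, 1], one of the angles of [t] and [1 - t] lies in [0, pi], where the cosine is
    injective. *)
Lemma cos1_int (t : R) : `|t| <= 1 -> cos (2 * pi * t) = 1 -> exists m : int, t = m%:~R.
Proof.
have pi0 := pi_gt0 R.
wlog t0 : t / 0 <= t.
  move=> H; have [/H//|t0 t1 ct] := leP 0 t.
  have [|||m tm] := H (- t); rewrite ?normrN ?mulrN ?cosN ?oppr_ge0 ?(ltW t0)//.
  by exists (- m); rewrite rmorphN /= -tm opprK.
rewrite ger0_norm// => t1 ct; have [th|th] := leP t 2^-1.
  exists 0; have : 2 * pi * t = 0.
    apply: (@cos_inj R); rewrite ?cos0// in_itv /=; last by rewrite lexx ltW.
    by apply/andP; split; nra.
  by move=> e; nra.
exists 1; have : 2 * pi * (1 - t) = 0.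
  apply: (@cos_inj R); last first.
  - have -> : 2 * pi * (1 - t) = - (2 * pi * t) + pi *+ 2 by rewrite mulr2n; ring.
    by rewrite cosD2pi cosN cos0.
  - by rewrite in_itv /= lexx ltW.
  - by rewrite in_itv /=; apply/andP; split; nra.
by move=> e; nra.
Qed.

Lemma periodic_int (f : R -> R) (t : R) (m : int) : periodic f (pi *+ 2) ->
  f (2 * pi * (t + m%:~R)) = f (2 * pi * t).
Proof.
move=> pf.
have P n u : f (2 * pi * (u + n%:R)) = f (2 * pi * u).
  rewrite -(periodicn pf n (2 * pi * u)); congr f.
  by rewrite -mulr_natr -[pi *+ 2]mulr_natr; ring.
case: m => n; first exact: P.
by rewrite NegzE rmorphN /= -[X in _ = f (_ * X)](subrK n.+1%:R t) P.
Qed.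

Lemma wrap_eq (b b' : 'rV[R]_d) : cube b -> cube b' ->
  wrap b = wrap b' <-> forall i, exists m : int, b ord0 i - b' ord0 i = m%:~R.
Proof.
move=> cb cb'; split=> [e i|h].
  have ci : cos (2 * pi * b ord0 i) = cos (2 * pi * b' ord0 i).
    by move/matrixP/(_ i 0) : e; rewrite !mxE eqxx.
  have si : sin (2 * pi * b ord0 i) = sin (2 * pi * b' ord0 i).
    by move/matrixP/(_ i 1) : e; rewrite !mxE.
  apply: cos1_int.
    have := cb i; have := cb' i; rewrite /= !in_itv /= ler_norml; lra.
  (* The cosine of the difference of the two angles is [cos ^ 2 + sin ^ 2 = 1]. *)
  by rewrite mulrBr cosB ci si -!expr2 cos2Dsin2.
apply/matrixP => i j; rewrite !mxE.
have [m bm] := h i.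
have -> : b ord0 i = b' ord0 i + m%:~R by rewrite -bm addrC subrK.
by rewrite !periodic_int//; [exact: sinD2pi|exact: cosD2pi].
Qed.

Lemma wrap_torus : wrap @` cube = @torus R d.
Proof.
apply/seteqP; split=> [_ [b _ <-] i|x tx]; first by rewrite !mxE eqxx /= cos2Dsin2.
have ex i : exists2 t, 0 <= t <= 1 & x i 0 = cos (2 * pi * t) /\ x i 1 = sin (2 * pi
  * t).
  have xi := tx i; have pi0 := pi_gt0 R.
  have x0 : -1 <= x i 0 <= 1 by apply/andP; split; nra.
  have [/andP[a0 a1] ca] := acos_def x0.
  have sa : sin (acos (x i 0)) = `|x i 1|.
    by rewrite sin_acos// -sqrtr_sqr; congr Num.sqrt; lra.
  have pi2 : 2 * pi != 0 :> R by rewrite mulf_neq0 ?gt_eqF// ltr0n.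
  (* [acos] covers the upper half circle; on the lower half the angle is its reflection. *)
  have [x1|x1] := leP 0 (x i 1).
    exists (acos (x i 0) / (2 * pi)).
      by rewrite divr_ge0 ?mulr_ge0 ?ler0n ?(ltW pi0)//= ler_pdivrMr ?mulr_gt0
        ?ltr0n//; nra.
    by rewrite mulrC mulfVK// ca sa ger0_norm.
  exists (1 - acos (x i 0) / (2 * pi)).
    have : 0 <= acos (x i 0) / (2 * pi) <= 1.
      by rewrite divr_ge0 ?mulr_ge0 ?ler0n ?(ltW pi0)//= ler_pdivrMr ?mulr_gt0
        ?ltr0n//; nra.
    by lra.
  rewrite mulrBr mulr1 [2 * pi * (_ / _)]mulrC mulfVK//.
  have -> : 2 * pi - acos (x i 0) = - acos (x i 0) + pi *+ 2 by rewrite mulr2n; ring.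
  by rewrite cosD2pi sinD2pi cosN sinN ca sa ltr0_norm// opprK.
pose b := \row_i sval (cid2 (ex i)).
exists b; first by move=> i /=; rewrite in_itv mxE; case: cid2.
apply/matrixP => i j; rewrite !mxE; case: cid2 => t _ [e0 e1] /=.
case: ifPn => [/eqP->//|j0]; have -> // : j = 1.
by apply: val_inj; case: j j0 => -[|[|//]].
Qed.

End Torus.

Lemma ptws_continuous (X : topologicalType) (U : choiceType) (R : realType)
    (f : X -> {ptws U -> R}) :
  (forall u, continuous (fun x => f x u)) -> continuous f.
Proof.
move=> cf x; apply/cvg_sup => u.
rewrite cvg_image; last by rewrite eqEsubset; split=> v // _; exists (cst v).
move: (cf u x) => + W /=; rewrite ?nbhs_simpl => Q => /Q Q';
  exists (@^~ u @^-1` W) => //.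
by rewrite eqEsubset; split => [j [? + <-//]|j Wj]; exists (fun _ => j).
Qed.

Lemma sum_continuous (X : topologicalType) (R : realType) (I : Type) (s : seq I)
    (f : I -> X -> R) :
  (forall i, continuous (f i)) -> continuous (fun x => \sum_(i <- s) f i x).
Proof.
move=> cf; elim: s => [|i s IH].
  have -> : (fun x => \sum_(i <- [::]) f i x) = cst 0 by apply/funext => x;
    rewrite big_nil.
  by move=> x; exact: cst_continuous.
have -> : (fun x => \sum_(j <- i :: s) f j x) = (fun x => f i x + \sum_(j <- s) f j x).
  by apply/funext => x; rewrite big_cons.
by move=> x; apply: (@continuousD R R); [exact: cf|exact: IH].
Qed.

Section Ext0.
Variables (K : nmodType) (d : nat).
Implicit Type p : 'rV[K]_d.

(** Picks the representative with first coordinate 0 modulo constants, so that d parameters describe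
    [V]. *)
Definition ext0 p : 'rV[K]_d.+1 := \row_i if unlift ord0 i is Some j then p 0 j else 0.

Lemma ext0_0 p : ext0 p 0 ord0 = 0.
Proof. by rewrite mxE unlift_none. Qed.

Lemma ext0_lift p j : ext0 p 0 (lift ord0 j) = p 0 j.
Proof. by rewrite mxE liftK. Qed.

Lemma ext0D p q : ext0 (p + q) = ext0 p + ext0 q.
Proof.
apply/rowP => i; rewrite rowvD; case: (unliftP ord0 i) => [j ->|->].
  by rewrite !ext0_lift rowvD.
by rewrite !ext0_0 addr0.
Qed.
End Ext0.

Section TkRealization.
Variables (R : realType) (d : nat) (k : 'I_d.+1 -> nat).
Hypothesis d_gt0 : (0 < d)%N.
Hypothesis k_gt0 : forall i, (0 < k i)%N.
Notation vec := 'rV[R]_d.+1.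
Notation T := (Tk R k).
Notation int_pt := (@int_pt R d).
Notation cell_class := (@cell_class R d k).
Notation period := (@period R d k).
Implicit Types (x y z u v w : vec) (a b c : 'rV[int]_d.+1) (i j : 'I_d.+1).

(** At most one term is non-zero, because the vertices of a cell have distinct classes; the sum
    avoids choosing a lift of [C]. *)
Definition bary_coords x : {ptws face_type T -> R} :=
  fun C => \sum_(v <- cell_verts x | cell_class v == C) hat v x.

Lemma bary_coords_class x v : v \in cell_verts x ->
  bary_coords x (cell_class v) = hat v x.
Proof.
move=> vx; rewrite /bary_coords big_mkcond (bigD1_seq v)//= ?cell_verts_uniq// eqxx.
rewrite big_seq_cond big1 ?addr0// => w /andP[wx wv].
by case: eqP => // /(cell_class_inj_star d_gt0 k_gt0 wx vx) e; rewrite e eqxx in wv.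
Qed.

Lemma bary_coords_out x (C : face_type T) : (forall v, v \in cell_verts x ->
  cell_class v <> C) -> bary_coords x C = 0.
Proof.
by move=> h; rewrite /bary_coords big_seq_cond big1// => v /andP[/h + /eqP].
Qed.

Lemma bary_coords_cases x (C : face_type T) :
  bary_coords x C = 0 \/ exists2 v,
    v \in cell_verts x & C = cell_class v /\ bary_coords x C = hat v x.
Proof.
have [[v vx e]|h] := pselect (exists2 v, v \in cell_verts x & cell_class v = C).
  by right; exists v => //; split => //; rewrite -e bary_coords_class.
by left; apply: bary_coords_out => v vx e; apply: h; exists v.
Qed.

Lemma bary_coords_ge0 x C : 0 <= bary_coords x C.
Proof. by apply: sumr_ge0 => v _; exact: hat_ge0. Qed.

Lemma hat_le_bary x a : hat (int_pt a) x <= bary_coords x (cell_class (int_pt a)).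
Proof.
case: (boolP (int_pt a \in cell_verts x)) => ax; first by rewrite bary_coords_class.
by rewrite hat_notin// bary_coords_ge0.
Qed.

(** The same lift [v] of [C] is compared at both points; [hat_le_bary] covers the case where [v] is
    not a vertex of the cell of [y]. *)
Lemma bary_coords_lip x y C : bary_coords x C <= bary_coords y C + spread (x - y).
Proof.
have [->|[v vx [-> ->]]] := bary_coords_cases x C;
  first by rewrite addr_ge0 ?bary_coords_ge0 ?spread_ge0.
apply: le_trans (hat_lip v x y) _; rewrite lerD2r.
by have /mem_cell_verts[[a ->] _] := vx; exact: hat_le_bary.
Qed.

Lemma spread_norm z : spread z <= 2 * `|z|.
Proof.
have e i : `|z 0 i| <= `|z|.
  by rewrite /Num.norm /= mx_normrE;
    exact: (le_bigmax _ (fun ij => `|z ij.1 ij.2|) (0, i)).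
apply/spread_leP; split=> [|i j]; first by rewrite mulr_ge0.
by have := e i; have := e j; rewrite !ler_norml; lra.
Qed.

Lemma bary_coords_continuous : continuous bary_coords.
Proof.
apply: ptws_continuous => C x A /nbhs_ballP[e /= e0 eA].
suff : nbhs x ((fun y => bary_coords y C) @^-1` A) by [].
have e2 : 0 < e / 2 by rewrite divr_gt0.
apply: filterS (nbhsx_ballx x (e / 2) e2) => y; rewrite -ball_normE /= => xy.
apply: eA; rewrite -ball_normE /=.
have h1 := bary_coords_lip x y C; have h2 := bary_coords_lip y x C.
rewrite -opprB spreadN in h2.
by have := spread_norm (x - y); rewrite ltr_norml; lra.
Qed.

Lemma cell_verts_V v x : v \in cell_verts x -> hyperplane_V v.
Proof. by move=> /mem_cell_verts[[a ->] _]; exact: int_pt_V. Qed.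

Lemma hat_period v x b : hat (v + period b) (x + period b) = hat v x.
Proof. by rewrite /hat opprD addrACA subrr addr0. Qed.

Lemma mem_cell_verts_period v x b : (v + period b \in cell_verts (x + period b)) = (v
  \in cell_verts x).
Proof.
apply/idP/idP => /mem_cell_verts[[a va] ax]; apply/mem_cell_verts; split.
- by exists (a - b *m Mk k); rewrite int_ptB -va addrK.
- exact/(cell_le_add_intE (b *m Mk k)).
- by exists (a + b *m Mk k); rewrite int_ptD -va.
- exact/(cell_le_add_intE (b *m Mk k)).
Qed.

Lemma bary_coords_period x b : bary_coords (x + period b) = bary_coords x.
Proof.
apply/funext => C; have [[v vx e]|h] := pselect (exists2 v,
  v \in cell_verts x & cell_class v = C).
  rewrite -e (bary_coords_class vx) -(cell_class_period k v b) bary_coords_class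
    ?mem_cell_verts_period//; exact: hat_period.
rewrite bary_coords_out ?bary_coords_out// => v vx e; apply: h.
  by exists v.
exists (v - period b); last by rewrite -e -[in RHS](subrK (period b) v)
  cell_class_period.
by rewrite -(mem_cell_verts_period _ _ b) subrK.
Qed.

(** The classes with positive coordinate are those of the vertices of the cell, so one period
    carries the vertices of [x] to those of [y]. The points then agree because [hat_decomp] recovers
    them from their coordinates. *)
Lemma bary_coords_inj x y : hyperplane_V x -> hyperplane_V y ->
  bary_coords x = bary_coords y -> exists b, x + period b = y.
Proof.
move=> Vx Vy e.
have pos v z : v \in cell_verts z ->
  0 < hat v z by move=> /mem_cell_verts[[a ->]] /hat_gt0P.
have sub z z' : bary_coords z = bary_coords z' -> forall v, v \in cell_verts z ->
  exists2 w, w \in cell_verts z' & cell_class w = cell_class v.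
  move=> ezz v vz; apply: contrapT => h.
  have : bary_coords z' (cell_class v) = 0 by apply: bary_coords_out => w wz' wv;
    apply: h; exists w.
  by rewrite -ezz bary_coords_class// => h0; have := pos _ _ vz; rewrite h0 ltxx.
have [b hb] := vertices_of_sub d_gt0 k_gt0 Vx Vy (sub _ _ e).
exists b; rewrite (hat_decomp (VD_period k b Vx)) [RHS](hat_decomp Vy).
have sb v : v \in cell_verts (x + period b) -> v \in cell_verts y.
  move=> vx; have := hb (v - period b); rewrite subrK; apply.
  by rewrite -(mem_cell_verts_period _ _ b) subrK.
have eb : bary_coords (x + period b) = bary_coords y by rewrite bary_coords_period.
have -> : \sum_(v <- cell_verts y) hat v y *: v = \sum_(v <- cell_verts (x + period
  b)) hat v y *: v.
  apply: perm_big; apply: uniq_perm; rewrite ?cell_verts_uniq// => v;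
    apply/idP/idP => [vy|/sb//].
  have [w wx e'] := sub _ _ (esym eb) v vy.
  by rewrite -(cell_class_inj_star d_gt0 k_gt0 (sb _ wx) vy e').
rewrite big_seq [RHS]big_seq; apply: eq_bigr => v vx; congr (_ *: _).
by rewrite -(bary_coords_class vx) eb bary_coords_class// sb.
Qed.

Lemma sum_vertices_of (f : face_type T -> R) x : hyperplane_V x ->
  \sum_(C \in vertices_of (cell_class x)) f C = \sum_(v <- cell_verts x) f
    (cell_class v).
Proof.
move=> Vx; rewrite (vertices_ofE k Vx).
rewrite (fsbig_seq _ _ (cell_verts_uniq x)).
rewrite (reindex_fsbig cell_class [set` cell_verts x])//.
split=> [v vx|v w /set_mem vx /set_mem wx|//]; first by exists v.
exact: (cell_class_inj_star d_gt0 k_gt0 vx wx).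
Qed.

Lemma bary_coords_realization : bary_coords @` (@hyperplane_V R d) = realization (K
  := T).
Proof.
apply/seteqP; split=> [_ [x Vx <-]|t [F [/facesP[x Vx ->] t0 tv t1]]].
  exists (cell_class x); split; first exact: faces_cell_class.
  - by move=> C; exact: bary_coords_ge0.
  - move=> C; have [->|[v vx [-> _]]] := bary_coords_cases x C; first by rewrite eqxx.
    by move=> _; rewrite vertices_ofE//; exists v.
  rewrite sum_vertices_of// -[RHS](hat_sum Vx) big_seq [RHS]big_seq.
  by apply: eq_bigr => v vx; rewrite bary_coords_class.
rewrite sum_vertices_of// in t1.
(* The point of the closed cell of [x] with barycentric coordinates [t]. Its own cell is the face
   spanned by the vertices with positive weight, possibly a proper one. *)
pose y := \sum_(v <- cell_verts x) t (cell_class v) *: v.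
have hy a : hat (int_pt a) y = if int_pt a \in cell_verts x then t (cell_class
  (int_pt a)) else 0.
  by rewrite /y (hat_combo (t := fun v => t (cell_class v))).
have Vy : hyperplane_V y.
  rewrite /y big_seq; apply: (big_ind (@hyperplane_V R d)).
  - by rewrite -(int_pt0 R d); exact: int_pt_V.
  - exact: VD.
  - by move=> v vx; apply: VZ; exact: cell_verts_V vx.
exists y => //; apply/funext => C.
have yx v : v \in cell_verts y -> v \in cell_verts x /\ hat v y = t (cell_class v).
  move=> /mem_cell_verts[[a ->]] /hat_gt0P; rewrite hy; case: ifP => //;
    by rewrite ltxx.
have [[v vy e]|h] := pselect (exists2 v, v \in cell_verts y & cell_class v = C).
  by rewrite -e bary_coords_class//; have [] := yx v vy.
rewrite bary_coords_out => [|v vy e]; last by apply: h; exists v.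
apply/esym/eqP; apply: contrapT => /negP /[dup] tC /tv;
  rewrite vertices_ofE// => -[v vx e].
apply: h; exists v => //; have /mem_cell_verts[[a va] _] := vx.
apply/mem_cell_verts; split; first by exists a.
by rewrite va; apply/hat_gt0P; rewrite hy -va vx e lt_neqAle eq_sym tC t0.
Qed.

(** * Coordinates with respect to a basis of the periods *)

Definition Mk_R : 'M[R]_d.+1 := map_mx intr (Mk k).

Implicit Types (p q : 'rV[R]_d).

(** Coordinates on [V] in the basis given, modulo constants, by all rows of [Mk k] but the first;
    the omitted row is minus the sum of the others, because all rows add up to a constant. The image
    of the unit cube is a closed fundamental parallelotope of the periods. *)
Definition frame p : vec := vproj (ext0 p *m Mk_R).

Lemma frameD p q : frame (p + q) = frame p + frame q.
Proof. by rewrite /frame -vprojD -mulmxDl ext0D. Qed.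

Lemma frame_int (m : 'rV[int]_d) : frame (map_mx intr m) = period (ext0 m).
Proof.
rewrite /frame /period /int_pt map_mxM; congr (vproj (_ *m _)); apply/rowP => i.
rewrite [RHS]mxE; case: (unliftP ord0 i) => [j ->|->]; first by rewrite !ext0_lift mxE.
by rewrite !ext0_0.
Qed.

Lemma mul_const_Mk_R (t : R) : const_mx t *m Mk_R = const_mx t :> 'rV_d.+1.
Proof.
have -> : const_mx t = t *: map_mx intr (const_mx 1) :> 'rV[R]_d.+1.
  by apply/rowP => i; rewrite !mxE mulr1.
by rewrite -scalemxAl -map_mxM mul_const_Mk.
Qed.

Lemma Mk_R_unit : Mk_R \in unitmx.
Proof.
rewrite unitmxE det_map_mx unitfE intr_eq0 gt_eqF//.
exact: Dk_gt0.
Qed.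

Lemma row_split x : exists t p, x = const_mx t + ext0 p.
Proof.
exists (x 0 ord0), (\row_j (x 0 (lift ord0 j) - x 0 ord0)).
apply/rowP => i; rewrite rowvD [const_mx _ _ _]mxE.
case: (unliftP ord0 i) => [j ->|->]; first by rewrite ext0_lift mxE addrC subrK.
by rewrite ext0_0 addr0.
Qed.

Lemma frame_surj x : hyperplane_V x -> exists p, frame p = x.
Proof.
move=> Vx; have [t [p e]] := row_split (x *m invmx Mk_R).
exists p; rewrite -(vproj_id Vx) -{1}(mulmxKV Mk_R_unit x) e mulmxDl mul_const_Mk_R.
by rewrite vprojD vproj_const add0r.
Qed.

(** The two sides agree before projection up to a constant. As [Mk_R] fixes constants, this constant
    can be moved to the input and the invertible matrix cancelled; the first coordinate, 0 on the
    left, then shows the constant to be an integer. *)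
Lemma frame_period p : (exists c, frame p = period c) <->
  (forall l, exists m : int, p 0 l = m%:~R).
Proof.
split=> [[c e] l|h].
  have [t et] : exists t, ext0 p *m Mk_R = map_mx intr c *m Mk_R + const_mx t.
    exists ((ext0 p *m Mk_R) 0 ord0 - (map_mx intr c *m Mk_R) 0 ord0).
    apply/rowP => j; rewrite rowvD [const_mx _ _ _]mxE.
    have := congr1 (fun z : vec => z 0 j - z 0 ord0) e.
    rewrite /frame /period /int_pt map_mxM !vproj_diff -/Mk_R.
    move: (ext0 p *m Mk_R) (map_mx intr c *m Mk_R) => A B; lra.
  rewrite -mul_const_Mk_R -mulmxDl in et.
  have {}et := can_inj (mulmxK Mk_R_unit) et.
  have e0 := congr1 (fun z : vec => z 0 ord0) et.
  have el := congr1 (fun z : vec => z 0 (lift ord0 l)) et.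
  move: e0 el; rewrite /= ext0_0 ext0_lift !rowvD !mxE => e0 el.
  exists (c 0 (lift ord0 l) - c 0 ord0); rewrite rmorphB /= el.
  by lra.
have -> : p = map_mx intr (\row_l sval (cid (h l))).
  by apply/rowP => l; rewrite !mxE; case: cid.
by rewrite frame_int; eexists.
Qed.

Lemma frame_continuous : continuous frame.
Proof.
apply: mx_continuous => i j.
have -> : (fun p => frame p i j) =
   (fun p => \sum_(l < d) (p ord0 l * vproj (row (lift ord0 l) Mk_R) 0 j)).
  apply/funext => p; rewrite (ord1 i) /frame.
  have -> : ext0 p *m Mk_R = \sum_(l < d) (p ord0 l *: row (lift ord0 l) Mk_R).
    apply/rowP => l; rewrite mxE big_ord_recl ext0_0 mul0r add0r summxE.
    by apply: eq_bigr => m _; rewrite ext0_lift !mxE.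
  rewrite (big_morph _ (@vprojD R d) (_ : vproj 0 = 0)); last first.
    by rewrite -[X in vproj X](scale0r (0 : vec)) vprojZ scale0r.
  by rewrite summxE; apply: eq_bigr => l _; rewrite vprojZ mxE.
apply: sum_continuous => l p.
apply: (@continuousM R _ (fun p : 'rV[R]_d => p ord0 l)); last exact: cst_continuous.
exact: coord_continuous_row.
Qed.

Lemma Tk_torus : homeomorphic (@realization R T) (@torus R d).
Proof.
apply: (@quotient_homeomorphic 'rV[R]_d _ _ (@cube R d) (bary_coords \o frame) (@wrap
  R d)).
- by exists 0 => i /=; rewrite mxE in_itv /= lexx ler01.
- exact: cube_compact.
- by apply: hausdorff_product => ?; exact: Rhausdorff.
- exact: norm_hausdorff.
- move=> b; apply: continuous_comp; first exact: frame_continuous.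
  exact: bary_coords_continuous.
- exact: wrap_continuous.
- rewrite -bary_coords_realization; apply/seteqP; split=> [_ [b cb <-]|_ [x Vx <-]].
    by exists (frame b) => //; exact: vproj_V.
  have [b <-] := frame_surj Vx.
  pose c : 'rV[int]_d := \row_l Num.floor (b 0 l).
  exists (b - map_mx intr c).
    by move=> l /=; rewrite !mxE in_itv /=; have := floor_itv (b 0 l); rewrite intrD;
      lra.
  rewrite /= -(bary_coords_period _ (ext0 c)) -frame_int -frameD subrK.
  by [].
- exact: wrap_torus.
- move=> b b' cb cb'; rewrite wrap_eq//=.
  have -> : (forall l, exists m : int, b ord0 l - b' ord0 l = m%:~R) <->
            (forall l, exists m : int, (b - b') 0 l = m%:~R).
    by split=> h l; have [m e] := h l; exists m; rewrite -e !rowvE.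
  rewrite -frame_period; split.
    move=> /bary_coords_inj[]; [exact: vproj_V|exact: vproj_V|move=> c e].
    exists (- c); apply: (addrI (frame b')); rewrite -frameD addrC subrK -e periodN.
    by rewrite addrK.
  move=> [c e]; rewrite -(subrK b' b) frameD e addrC.
  exact: bary_coords_period.
Qed.

End TkRealization.

(** * Counting the faces *)

Lemma size_undup_map (I : Type) (T1 T2 : eqType) (f : I -> T1) (g : I ->
  T2) (s : seq I) :
  (forall i j, f i = f j <-> g i = g j) ->
  size (undup (map f s)) = size (undup (map g s)).
Proof.
move=> fg; have mem i s' : (f i \in map f s') = (g i \in map g s').
  elim: s' => //= j s' IH; rewrite !inE IH; congr (_ || _).
  by apply/eqP/eqP => /fg.
by elim: s => //= i s IH; rewrite mem; case: ifP => //= _; rewrite IH.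
Qed.

Lemma size_undup_surj n m (p : 'I_n -> 'I_m) : is_surj p ->
  size (undup (map p (enum 'I_n))) = m.
Proof.
move=> /fintype.forallP ps; rewrite -[RHS](size_enum_ord m); apply: perm_size.
apply: uniq_perm; rewrite ?undup_uniq ?enum_uniq// => c.
rewrite mem_undup mem_enum inE; have /fintype.existsP[i /eqP <-] := ps c.
by apply: map_f; rewrite mem_enum.
Qed.

(* The surjections of ['I_n] onto ['I_m.+1] are determined by the preorder they
   induce. *)
Lemma surj_le n m (p q : 'I_n -> 'I_m.+1) : is_surj p ->
  (forall i j, q i <= q j -> p i <= p j)%N -> forall i, (p i <= q i)%N.
Proof.
move=> /fintype.forallP ps pq i; have [c] := ubnP (p i); elim: c i => // c IH i.
rewrite ltnS => pc; have [->//|p0] := posnP (p i).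
have lt : ((p i).-1 < m.+1)%N by rewrite (leq_ltn_trans (leq_pred _)).
have /fintype.existsP[j /eqP vproj] := ps (Ordinal lt).
have vprojE : p j = (p i).-1 :> nat by rewrite vproj.
have /IH h : (p j < c)%N by rewrite vprojE prednK.
have : (q j < q i)%N.
  by rewrite ltnNge; apply/negP => /pq; rewrite vprojE leqNgt prednK// leqnn.
by move: h; rewrite vprojE; lia.
Qed.

Lemma intr_mulrn (K : pzRingType) (z : int) n : (z *+ n)%:~R = z%:~R * n%:R :> K.
Proof. by rewrite rmorphMn /= mulr_natr. Qed.

Lemma intr_small (K : numDomainType) (z : int) : -1 < (z%:~R : K) < 1 -> z = 0.
Proof.
move=> /andP[h1 h2]; have : -1 < z by rewrite -(ltr_int K) rmorphN1.
have : z < 1 by rewrite -(ltr_int K).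
by lia.
Qed.

Lemma frac_diff (K : realFieldType) (u v a b z : K) : 0 <= u < 1 -> 0 <= v < 1 ->
  a + v - (b + u) = z -> -1 < z - (a - b) < 1.
Proof. by move=> *; apply/andP; split; lra. Qed.

(** * Normal forms of cells *)

Section Barycenters.
Variables (R : realType) (d : nat).
Notation vec := 'rV[R]_d.+1.
Notation I := 'I_d.+1.
Notation int_pt := (@int_pt R d).
Implicit Types (x y z u v w : vec) (a b c X Y : 'rV[int]_d.+1) (i j : I).

(** Comparing a difference of coordinates with an integer involves only the integer parts and the
    order of the fractional parts. With common integer parts, containment thus reduces to comparing
    two preorders. *)
Lemma cell_le_frac a (f g : I -> R) x y :
  (forall i, 0 <= f i < 1) -> (forall i, 0 <= g i < 1) ->
  (forall i j, x 0 j - x 0 i = (a 0 j)%:~R + f j - ((a 0 i)%:~R + f i)) ->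
  (forall i j, y 0 j - y 0 i = (a 0 j)%:~R + g j - ((a 0 i)%:~R + g i)) ->
  (forall i j, g j <= g i -> f j <= f i) -> cell_le x y.
Proof.
move=> f01 g01 xf yg gf i j m; rewrite xf yg => h.
have := f01 i; have := f01 j; have := g01 i; have := g01 j => gj gi fj fi.
have [am|ma] := leP (a 0 j - a 0 i + 1) m.
  by rewrite -(ler_int R) intrD intrB in am; lra.
have {}ma : m <= a 0 j - a 0 i by rewrite -ltzD1.
have [e|ne] := eqVneq m (a 0 j - a 0 i).
  have := gf i j; move: h; rewrite e intrB => h; have -> : g j <= g i by lra.
  by move=> /(_ isT); lra.
have : m + 1 <= a 0 j - a 0 i by rewrite lezD1 lt_neqAle ne.
by rewrite -(ler_int R) intrD intrB => ?; lra.
Qed.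

Lemma cell_verts_size_eq (T : eqType) (p : I -> T) x :
  (forall i j, (exists m : int, x 0 j - x 0 i = m%:~R) <-> p i = p j) ->
  size (cell_verts x) = size (undup (map p (enum I))).
Proof.
by move=> xp; apply: size_undup_map => i j; rewrite floor_row_eq xp.
Qed.

Definition scaled_pt (m : nat) X : vec := vproj (\row_i ((X 0 i)%:~R / m%:R)).

Lemma scaled_pt_diff m X i j : scaled_pt m X 0 j - scaled_pt m X 0 i = (X 0 j - X 0
  i)%:~R / m%:R.
Proof. by rewrite vproj_diff !mxE intrB mulrBl. Qed.

Lemma scaled_pt_V m X : hyperplane_V (scaled_pt m X). Proof. exact: vproj_V. Qed.

Lemma scaled_pt_add_int m X a : (0 < m)%N ->
  scaled_pt m X + int_pt a = scaled_pt m (X + a *+ m).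
Proof.
move=> m0; rewrite /scaled_pt /int_pt -vprojD; congr vproj; apply/rowP => i;
  rewrite !mxE.
have mE (n : nat) : (a *+ n) 0 i = a 0 i *+ n.
  by elim: n => [|n IH]; rewrite ?mulr0n ?mxE// !mulrS rowvD IH.
by rewrite mE intrD mulrDl intr_mulrn mulfK// pnatr_eq0 -lt0n.
Qed.

(** Divided by [m.+1], the vector has integer parts [a] and fractional parts [p / m.+1]. For [p]
    surjective it is a normal form of the cells with [m.+1] vertices, unique modulo constants once
    [p ord0 = ord0]. *)
Definition chart m a (p : I -> 'I_m.+1) : 'rV[int]_d.+1 :=
  \row_i (a 0 i *+ m.+1 + (p i)%:Z).

Lemma chart_diff m a (p : I -> 'I_m.+1) i j :
  scaled_pt m.+1 (chart a p) 0 j - scaled_pt m.+1 (chart a p) 0 i =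
  (a 0 j)%:~R + (p j)%:R / m.+1%:R - ((a 0 i)%:~R + (p i)%:R / m.+1%:R).
Proof.
rewrite scaled_pt_diff !mxE !intrB !intrD !intr_mulrn /=.
have m0 : m.+1%:R != 0 :> R by rewrite pnatr_eq0.
by rewrite mulrBl !mulrDl !mulfK//; ring.
Qed.

Lemma frac01 m (c : 'I_m.+1) : 0 <= (c%:R / m.+1%:R : R) < 1.
Proof.
by rewrite divr_ge0 ?ler0n//= ltr_pdivrMr ?ltr0Sn// mul1r ltr_nat ltn_ord.
Qed.

Lemma chart_size m a (p : I -> 'I_m.+1) : is_surj p ->
  size (cell_verts (scaled_pt m.+1 (chart a p))) = m.+1.
Proof.
move=> ps; rewrite (@cell_verts_size_eq _ p) ?size_undup_surj// => i j.
have pi := frac01 (p i); have vproj := frac01 (p j).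
rewrite chart_diff; split=> [[z e]|->]; last first.
  by exists (a 0 j - a 0 i); rewrite intrB; ring.
have : z - (a 0 j - a 0 i) = 0.
  by apply: (@intr_small R); rewrite !intrB; exact: frac_diff pi vproj e.
move=> /(congr1 (intr : int -> R)); rewrite !intrB -e => e0.
apply: val_inj => /=; apply/eqP; rewrite -(eqr_nat R).
have m0 : m.+1%:R^-1 != 0 :> R by rewrite invr_eq0 pnatr_eq0.
rewrite -(inj_eq (mulIf m0)); apply/eqP; move: e0; rewrite mulr0z.
by move: (_ / _) (_ / _) => u v; lra.
Qed.

Lemma chart_exists m x : size (cell_verts x) = m.+1 ->
  exists a (p : I -> 'I_m.+1), [/\ is_surj p, p ord0 = ord0,
    cell_le x (scaled_pt m.+1 (chart a p)) & cell_le (scaled_pt m.+1 (chart a p)) x].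
Proof.
pose a := \row_i Num.floor (x 0 i - x 0 ord0).
pose f i := x 0 i - x 0 ord0 - (a 0 i)%:~R.
have f01 i : 0 <= f i < 1.
  by rewrite /f /a mxE; have := floor_itv (x 0 i - x 0 ord0); rewrite intrD; lra.
have xf i j : x 0 j - x 0 i = (a 0 j)%:~R + f j - ((a 0 i)%:~R + f i).
  by rewrite /f; ring.
rewrite (@cell_verts_size_eq _ f) => [sz|i j]; last first.
  have fi := f01 i; have fj := f01 j; rewrite xf; split=> [[z e]|->]; last first.
    by exists (a 0 j - a 0 i); rewrite intrB; ring.
  have : z - (a 0 j - a 0 i) = 0.
    by apply: (@intr_small R); rewrite !intrB -e; apply/andP; split; lra.
  by move=> /(congr1 (intr : int -> R)); rewrite !intrB -e; lra.
(* The residue of a coordinate is the rank of its fractional part among the distinct ones. Measuring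
   from [x 0 ord0] gives coordinate [ord0] the fractional part 0 and so rank 0. *)
pose s := sort <=%R (undup [seq f i | i <- enum I]).
have szs : size s = m.+1 by rewrite size_sort.
have ss : sorted <%R s by rewrite sort_lt_sorted undup_uniq.
have fs i : f i \in s by rewrite mem_sort mem_undup map_f// mem_enum.
have ps i : (index (f i) s < m.+1)%N by rewrite -szs index_mem.
pose p i := Ordinal (ps i).
have fp i j : (f i <= f j) = (p i <= p j)%N.
  rewrite -[f i](nth_index 0 (fs i)) -[f j](nth_index 0 (fs j)).
  by rewrite (lt_sorted_leq_nth _ ss) ?inE ?index_mem.
have psurj : is_surj p.
  apply/fintype.forallP => c; have cs : (c < size s)%N by rewrite szs.
  have := mem_nth 0 cs; rewrite mem_sort mem_undup => /mapP[i _ e].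
  apply/fintype.existsP; exists i; apply/eqP/val_inj; rewrite /= -e index_uniq//.
  exact: lt_sorted_uniq.
have fr (i j : I) : (p j)%:R / m.+1%:R <= (p i)%:R / m.+1%:R :> R = (f j <= f i).
  by rewrite fp ler_pM2r ?ler_nat// invr_gt0 ltr0Sn.
exists a, p; split=> //.
- have /fintype.forallP/(_ ord0)/fintype.existsP[i /eqP pi] := psurj.
  apply: val_inj => /=; apply/eqP; rewrite -leqn0.
  have -> : index (f ord0) s = p ord0 :> nat by [].
  have -> : 0%N = p i by rewrite pi.
  have f0 : f ord0 = 0 by rewrite /f /a mxE subrr floor0 mulr0z subr0.
  by rewrite -fp f0; case/andP: (f01 i).
- by apply: (cell_le_frac f01 (fun i => frac01 (p i)) xf (@chart_diff m a p)) => i j;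
  rewrite fr.
- by apply: (cell_le_frac (fun i => frac01 (p i)) f01 (@chart_diff m a p) xf) => i j;
  rewrite fr.
Qed.

(** As both residues at [ord0] vanish, the integer parts are the rounded-down differences from
    coordinate [ord0], which equal cells share. The maps [p] and [q] then induce the same preorder,
    so [surj_le] applies both ways. *)
Lemma chart_inj m a b (p q : I -> 'I_m.+1) : is_surj p -> is_surj q ->
  p ord0 = ord0 -> q ord0 = ord0 ->
  cell_le (scaled_pt m.+1 (chart a p)) (scaled_pt m.+1 (chart b q)) ->
  cell_le (scaled_pt m.+1 (chart b q)) (scaled_pt m.+1 (chart a p)) ->
  (exists t, a = b + const_mx t) /\ p =1 q.
Proof.
move=> ps qs p0 q0 pq qp.
have half a' b' (p' q' : I -> 'I_m.+1) i : p' ord0 = ord0 -> q' ord0 = ord0 ->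
   cell_le (scaled_pt m.+1 (chart a' p')) (scaled_pt m.+1 (chart b' q')) ->
   b' 0 i - b' 0 ord0 <= a' 0 i - a' 0 ord0.
  move=> p0' q0' /(@cell_le_ge _ _ _ _ ord0 i (b' 0 i - b' 0 ord0)).
  have pi := frac01 (p' i); have qi := frac01 (q' i).
  rewrite !chart_diff p0' q0' mul0r !addr0 intrB => h.
  rewrite -ltzD1 -(ltr_int R) [ltRHS]intrD !intrB.
  move: h pi qi; move: (_ / _) (_ / _) => u v h pi qi.
  have /h : (b' 0 i)%:~R - (b' 0 ord0)%:~R <= (b' 0 i)%:~R + v - (b' 0 ord0)%:~R :> R
    by lra.
  by lra.
have ab i : a 0 i - a 0 ord0 = b 0 i - b 0 ord0.
  by apply/eqP; rewrite eq_le (half _ _ _ _ i p0 q0 pq) (half _ _ _ _ i q0 p0 qp).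
split.
  by exists (a 0 ord0 - b 0 ord0); apply/rowP => i; rewrite rowvD mxE; have := ab i;
    lra.
have leE (a' : 'rV[int]_d.+1) (p' : I -> 'I_m.+1) i j :
    (scaled_pt m.+1 (chart a' p') 0 j - scaled_pt m.+1 (chart a' p') 0 i <=
     (a' 0 j - a' 0 i)%:~R) = (p' j <= p' i)%N.
  rewrite chart_diff intrB -(ler_nat R) -(ler_pM2r (_ : 0 < m.+1%:R^-1)); last first.
    by rewrite invr_gt0 ltr0Sn.
  by move: ((p' j)%:R / _) ((p' i)%:R / _) => u v; apply/idP/idP; lra.
have abij i j : a 0 j - a 0 i = b 0 j - b 0 i by have := ab i; have := ab j; lra.
move=> i; apply: val_inj; apply/eqP; rewrite eqn_leq; apply/andP; split.
  apply: surj_le => // j j'; rewrite -(leE b q) -(leE a p) abij; exact: pq.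
apply: surj_le => // j j'; rewrite -(leE b q) -(leE a p) abij; exact: qp.
Qed.

End Barycenters.

Section Counting.
Variables (R : realType) (d : nat) (k : 'I_d.+1 -> nat).
Hypothesis d_gt0 : (0 < d)%N.
Hypothesis k_gt0 : forall i, (0 < k i)%N.
Notation vec := 'rV[R]_d.+1.
Notation T := (Tk R k).
Notation period := (@period R d k).
Notation cell_class := (@cell_class R d k).

(** A period changes only the integer parts of a normal form, by an element of the row lattice. The
    faces are thus enumerated by pairs of a coset representative and a pointed surjection. *)
Lemma faces_dim_card m : finite_set [set F : face_type T | faces F /\ face_dim F = m] /\
  (f_vector T m = `|Dk k| *
    #|[pred p : {ffun 'I_d.+1 -> 'I_m.+1} | is_surj p && (p ord0 == ord0)]|)%N.
Proof.
have [|Q [rep [cardQ rep_ex rep_inj]]] := @lattice_index _ (Mk k).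
  by rewrite gt_eqF// Dk_gt0.
set A := [pred p : {ffun _ -> _} | _].
pose F (t : Q * {ffun 'I_d.+1 -> 'I_m.+1}) : face_type T :=
  cell_class (scaled_pt R m.+1 (chart (rep t.1) t.2)).
pose s := [seq F t | t <- enum [predX predT & A]].
have shift (a b : 'rV[int]_d.+1) (p : 'I_d.+1 -> 'I_m.+1) :
    scaled_pt R m.+1 (chart a p) + period b = scaled_pt R m.+1 (chart (a + b *m Mk k)
      p).
  rewrite /period scaled_pt_add_int//; congr scaled_pt; apply/rowP => i;
    rewrite rowvD /chart !mxE.
  by rewrite mulrnDl addrAC; congr (_ + _ + _); elim: m.+1 => [|n IH];
    rewrite ?mulr0n ?mxE// !mulrS rowvD IH mxE.
have us : uniq s.
  rewrite map_inj_in_uniq ?enum_uniq// => -[r p] [r' p'].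
  rewrite !mem_enum !inE /= => /andP[ps /eqP p0] /andP[ps' /eqP p0'].
  move=> /cell_class_eqP[]; [exact: scaled_pt_V|exact: scaled_pt_V|move=> b;
    rewrite shift => -[h1 h2]].
  have [[t e] pp] := chart_inj ps ps' p0 p0' h1 h2.
  (* The constant ambiguity [t] of the normal form lies in the row lattice, so it does not affect
     the coset. *)
  have er : rep r' = rep r + (b + const_mx (- t)) *m Mk k.
    rewrite mulmxDl mul_const_Mk// addrA e -addrA -[LHS]addr0; congr (_ + _).
    by apply/rowP => i; rewrite !mxE subrr.
  by rewrite (rep_inj _ _ _ er); congr pair; apply/ffunP.
have sE : [set F : face_type T | faces F /\ face_dim F = m] = [set` s].
  apply/seteqP; split=> [C [/facesP[x Vx ->]]|C /mapP[[r p]]].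
    rewrite face_dimE// => sz.
    have {}sz : size (cell_verts x) = m.+1 by rewrite -sz prednK// cell_verts_gt0.
    have [a [p [ps p0 h1 h2]]] := chart_exists sz.
    have [r [b e]] := rep_ex a; apply/mapP; exists (r, finfun p).
      rewrite mem_enum !inE /= ffunE p0 eqxx andbT.
      apply/fintype.forallP => c; have /fintype.forallP/(_ c)/fintype.existsP[i /eqP
        <-] := ps.
      by apply/fintype.existsP; exists i; rewrite ffunE.
    rewrite -[F _]/(cell_class (scaled_pt R m.+1 (chart (rep r) (finfun p)))).
    rewrite -(cell_class_period k (scaled_pt _ _ _) b) shift -e.
    have -> : chart a (finfun p) = chart a p by apply/rowP => i; rewrite !mxE ffunE.
    by apply/cell_class_eqP => //; [exact: scaled_pt_V|exists 0; rewrite period0 addr0].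
  rewrite mem_enum !inE /= => /andP[ps _] ->.
  split; first exact/faces_cell_class/scaled_pt_V.
  by rewrite face_dimE ?chart_size//; exact: scaled_pt_V.
split; first by rewrite sE; exact: finite_seq.
rewrite /f_vector sE card_fset_set_seq// size_map -cardE cardX cardQ.
by [].
Qed.

Lemma face_dim_le (C : face_type T) : faces C -> (face_dim C <= d)%N.
Proof.
by move=> /facesP[x Vx ->]; rewrite face_dimE// -ltnS prednK ?cell_verts_gt0//
  cell_verts_size.
Qed.

Lemma Tk_finite : finite_complex T.
Proof.
apply: (@sub_finite_set _ _ (\bigcup_(m in `I_d.+1) [set F : face_type T | faces F /\
  face_dim F = m])).
  by move=> C fC; exists (face_dim C) => //=; rewrite ltnS face_dim_le.
apply: bigcup_finite; first exact: finite_II.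
by move=> m _; have [] := faces_dim_card m.
Qed.

Lemma f_vectorE i : (f_vector T i)%:R =
  i`!%:R * stirling2 d.+1 i.+1 * (Dk k)%:~R :> rat.
Proof.
have [_ ->] := faces_dim_card i; rewrite natrM card_surj_stirling mulrC; congr (_ * _).
by rewrite -[in RHS](gez0_abs (ltW (Dk_gt0 k d_gt0))).
Qed.

Lemma f_vector_int i (n : nat) : i`!%:R * stirling2 d.+1 i.+1 = n%:R ->
  (f_vector T i)%:Z = n%:Z * Dk k.
Proof.
move=> e; apply/eqP; rewrite -(eqr_int rat) intrM; apply/eqP.
by rewrite -[LHS]/((f_vector T i)%:R) f_vectorE e.
Qed.

End Counting.

(** * The dual graph *)

Section UndupPred.
Variables (d : nat) (T : eqType) (f : 'I_d.+1 -> T).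
Notation I := 'I_d.+1.

Lemma mem_undup_drop (i j : I) : i != j -> f i = f j ->
  map f (enum (predC1 i)) =i undup (map f (enum I)).
Proof.
move=> ij fij y; rewrite mem_undup; apply/mapP/mapP => -[l _ ->].
  by exists l; rewrite ?mem_enum.
have [->|li] := eqVneq l i; first by exists j; rewrite // mem_enum inE eq_sym.
by exists l; rewrite // mem_enum inE.
Qed.

Lemma size_drop (i : I) : size (map f (enum (predC1 i))) = d.
Proof.
have e : #|predC1 i| = d by have := cardC1 i; rewrite card_ord.
by rewrite size_map -cardE e.
Qed.

Lemma size_undup_pred (i j : I) : i != j -> f i = f j ->
  {in predC1 i &, injective f} -> size (undup (map f (enum I))) = d.
Proof.
move=> ij fij /dinjectiveP fi.
have := uniq_size_uniq (fi : uniq (map f (enum (predC1 i)))) (mem_undup_drop ij fij).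
by rewrite undup_uniq => /esym/eqP ->; exact: size_drop.
Qed.

(** Applied to the vertices of a ridge, this produces its unique pair of tied coordinates. *)
Lemma size_undup_predP : size (undup (map f (enum I))) = d ->
  exists i j, [/\ i != j, f i = f j &
    forall u w, u != w -> f u = f w -> u = i /\ w = j \/ u = j /\ w = i].
Proof.
move=> sz; have [i [j [ij fij]]] : exists i j, i != j /\ f i = f j.
  apply: contrapT => H; have fI : injective f.
    move=> i j fij; apply/eqP; apply: contrapT => /negP ij; apply: H.
    by exists i, j.
  have us : uniq (map f (enum I)) by rewrite map_inj_uniq// enum_uniq.
  by move: sz; rewrite undup_id// size_map size_enum_ord; lia.
exists i, j; split=> //.
have fi : {in predC1 i &, injective f}.
  apply/dinjectiveP; rewrite /dinjectiveb.
  have e y : (y \in undup (map f (enum I))) = (y \in map f (enum (predC1 i))).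
    by rewrite (mem_undup_drop ij fij).
  rewrite (uniq_size_uniq (undup_uniq (map f (enum I))) e); apply/eqP.
  by rewrite sz size_drop.
have ji : j != i by rewrite eq_sym.
move=> u w uw fuw; have [ui|ui] := eqVneq u i.
  have wi : w != i by rewrite -ui eq_sym.
  by left; split=> //; apply: (fi w j wi ji); rewrite -fuw ui.
have [wi|wi] := eqVneq w i.
  by right; split=> //; apply: (fi u j ui ji); rewrite fuw wi.
by rewrite (fi u w ui wi fuw) eqxx in uw.
Qed.

End UndupPred.

Lemma int_mulrn (z : int) m : z *+ m = z * m%:Z.
Proof. by rewrite -mulr_natr natz. Qed.

(** * Vertices of Gamma_d as centers of facets *)

Section GammaVertices.
Variables (R : realType) (d : nat).
Notation n := d.+1.
Notation vec := 'rV[R]_n.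
Notation I := 'I_n.
Implicit Types (x y z : vec) (a b c X Y : 'rV[int]_n) (i j u w : I).

Lemma modnzP (s t : int) : (s = t %[mod n%:Z])%Z <-> exists q, s - t = q * n%:Z.
Proof.
split=> [/eqP|[q e]]; first by rewrite eqz_mod_dvd => /dvdzP.
by apply/eqP; rewrite eqz_mod_dvd; apply/dvdzP; exists q.
Qed.

Definition center X : vec := scaled_pt R n X.

Definition quo X u w : int := divz (X 0 w - X 0 u) n%:Z.

Lemma center_le X i j (m : int) :
  (center X 0 j - center X 0 i <= m%:~R) = (X 0 j - X 0 i <= m * n%:Z).
Proof.
by rewrite scaled_pt_diff ler_pdivrMr ?ltr0Sn// -[n%:R]/(n%:Z%:~R) -intrM ler_int.
Qed.

Lemma Gamma_inj X : Gamma_vertices X -> forall i j q, X 0 j - X 0 i = q * n%:Z -> i = j.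
Proof.
move=> [_ res] i j q e; have [l [_ lu]] := res (X 0 i).
by rewrite -(lu i) // -(lu j) //; apply/modnzP; exists q.
Qed.

(** By pigeonhole, d+1 pairwise incongruent coordinates meet every residue class, so membership can
    be tested on differences. *)
Lemma Gamma_intro X : \sum_i X 0 i = \sum_(1 <= j < d.+2) j%:Z ->
  (forall i j q, X 0 j - X 0 i = q * n%:Z -> i = j) -> Gamma_vertices X.
Proof.
move=> sX Xi; split=> // r.
have lt (s : int) : (`|(s %% n%:Z)%Z| < n)%N.
  by rewrite -ltz_nat gez0_abs ?modz_ge0// ltz_pmod.
pose h i := Ordinal (lt (X 0 i)).
have hE (s t : int) : Ordinal (lt s) = Ordinal (lt t) -> (s = t %[mod n%:Z])%Z.
  by move=> /(congr1 val) /= /(congr1 Posz); rewrite !gez0_abs ?modz_ge0.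
have hi : injective h.
  by move=> i j /hE/modnzP[q] /Xi ->.
have [g hg gh] := injF_bij hi.
exists (g (Ordinal (lt r))); split; first by apply: hE; exact: gh.
move=> i ir; apply: hi; rewrite [LHS]gh; apply: val_inj => /=.
by rewrite ir.
Qed.

Lemma Gamma_size X : Gamma_vertices X -> size (cell_verts (center X)) = n.
Proof.
move=> gX; rewrite (@cell_verts_size_eq _ _ _ id).
  by rewrite map_id undup_id ?enum_uniq// size_enum_ord.
move=> i j; rewrite scaled_pt_diff; split=> [[q e]|->]; last first.
  by exists 0; rewrite subrr mul0r.
apply: (Gamma_inj gX (q := q)); apply: (@intr_inj R); by rewrite intrM -e mulfVK.
Qed.

(* Summing [X_w - X_u] over [w], the remainders mod [n] run through all
   residues: a vertex of [Gamma] is determined by its quotients. *)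
Lemma Gamma_quot X Y : Gamma_vertices X -> Gamma_vertices Y -> forall u,
  Y 0 u - X 0 u =
  \sum_w (quo X u w - quo Y u w).
Proof.
have F Z u : Gamma_vertices Z -> \sum_i Z 0 i - Z 0 u * n%:Z =
    (\sum_w quo Z u w) * n%:Z + \sum_(c < n) c%:Z.
  move=> gZ.
  have lt w : (`|modz (Z ord0 w - Z ord0 u)%R n%:Z| < n)%N.
    by rewrite -ltz_nat gez0_abs ?modz_ge0// ltz_pmod.
  pose h w := Ordinal (lt w).
  have hi : injective h.
    move=> i j /(congr1 val) /= /(congr1 Posz); rewrite !gez0_abs ?modz_ge0//.
    move=> /modnzP[q e]; apply/esym/(Gamma_inj gZ (q := q)); rewrite -e; ring.
  rewrite [X in _ = _ + X](reindex_inj hi) /= big_distrl -big_split /=.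
  have -> : Z 0 u * n%:Z = \sum_(w < n) Z 0 u.
    by rewrite sumr_const card_ord int_mulrn.
  rewrite -sumrB; apply: eq_bigr => w _.
  by rewrite gez0_abs ?modz_ge0// -divz_eq.
move=> gX gY u; have := F X u gX; have := F Y u gY.
rewrite (gX.1) (gY.1) sumrB.
move: (\sum_w quo X u w) (\sum_w quo Y u w) (\sum_(c < n) c%:Z) (\sum_(1 <= _ < _) _).
move=> QX QY K S e1 e2.
have : (Y 0 u - X 0 u - (QX - QY)) * n%:Z = 0.
  rewrite !mulrBl; move: e1 e2.
  by move: (Y 0 u * n%:Z) (X 0 u * n%:Z) (QY * n%:Z) (QX * n%:Z); lia.
by move=> /eqP; rewrite mulf_eq0 orbF subr_eq0 => /eqP.
Qed.

Lemma quo_floor X i j (m : int) :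
  (m <= quo X i j) = (m%:~R <= center X 0 j - center X 0 i).
Proof.
by rewrite /quo lez_divRL// scaled_pt_diff ler_pdivlMr ?ltr0Sn//
  -[n%:R]/(n%:Z%:~R) -intrM ler_int.
Qed.

(** Both cells have d+1 vertices, so containment is equality and the quotients coincide. The
    prescribed coordinate sum then removes the constant ambiguity, through [Gamma_quot]. *)
Lemma Gamma_eq X Y : Gamma_vertices X -> Gamma_vertices Y ->
  cell_le (center X) (center Y) -> X = Y.
Proof.
move=> gX gY xy.
have yx : cell_le (center Y) (center X).
  apply/cell_le_verts; have /cell_le_verts sub := xy.
  have [|_ h] := uniq_min_size (cell_verts_uniq _) sub; first by rewrite !Gamma_size.
  by move=> v; rewrite h.
apply/rowP => u; apply/eqP; rewrite eq_sym -subr_eq0 (Gamma_quot gX gY); apply/eqP.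
apply: big1 => w _; apply/eqP; rewrite subr_eq0 eq_le !quo_floor.
by apply/andP; split; [apply: (cell_le_ge yx)|apply: (cell_le_ge xy)];
  rewrite -quo_floor.
Qed.

(** Sorting the coordinates by fractional part, with ties broken arbitrarily, refines the preorder
    of [x] to a total order, that is, embeds its cell in a facet. *)
Lemma Gamma_exists x : exists2 X, Gamma_vertices X & cell_le x (center X).
Proof.
pose a := \row_i Num.floor (x 0 i - x 0 ord0).
pose f i := x 0 i - x 0 ord0 - (a 0 i)%:~R.
have f01 i : 0 <= f i < 1.
  by rewrite /f /a mxE; have := floor_itv (x 0 i - x 0 ord0); rewrite intrD; lra.
have xf i j : x 0 j - x 0 i = (a 0 j)%:~R + f j - ((a 0 i)%:~R + f i).
  by rewrite /f; ring.
pose r : rel I := fun i j => f i <= f j.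
pose s := sort r (enum I).
have rt : total r by move=> i j; exact: le_total.
have rtr : transitive r by move=> i j l; exact: le_trans.
have szs : size s = n by rewrite size_sort size_enum_ord.
have ins i : i \in s by rewrite mem_sort mem_enum.
have ps i : (index i s < n)%N by have := ins i; rewrite -index_mem szs.
pose p i := Ordinal (ps i).
have pinj : injective p.
  move=> i j /(congr1 val)/= e.
  by rewrite -(nth_index i (ins j)) -e nth_index.
have pf i j : (p j <= p i)%N -> f j <= f i.
  have rr : reflexive r by move=> l; exact: lexx.
  exact: (sorted_leq_index rtr rr (sort_sorted rt _) j i (ins j) (ins i)).
(* The coordinates of [chart a p] add up to [n (\sum a) + (0 + ... + d)]. Subtracting this constant
   from each leaves [n + (0 + ... + d) = 1 + ... + (d+1)]. *)
pose X := chart a p - const_mx (\sum_i a 0 i - 1).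
have chX i j : X 0 j - X 0 i = chart a p 0 j - chart a p 0 i.
  by rewrite /X !rowvD !rowvN ![const_mx _ _ _]mxE; ring.
exists X.
  apply: Gamma_intro.
    rewrite /X; under eq_bigr => i _ do rewrite rowvD rowvN ![const_mx _ _ _]mxE mxE.
    rewrite sumrB big_split /= sumr_const card_ord.
    have -> : \sum_i (p i)%:Z = \sum_(c < n) c%:Z.
      by rewrite [RHS](reindex_inj pinj).
    have -> : \sum_(1 <= c < d.+2) c%:Z = \sum_(c < n) c%:Z + n%:Z.
      rewrite big_add1 big_mkord /=; under eq_bigr => c _ do rewrite -addn1 PoszD.
      by rewrite big_split /= sumr_const card_ord natz.
    rewrite sumrMnl mulrnBl natz.
    have h (A K N : int) : A + K - (A - N) = K + N by ring.
    exact: h.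
  move=> i j q; rewrite chX !mxE => e; apply: pinj; apply: ord_inj.
  have := ltn_ord (p i); have := ltn_ord (p j); move: e.
  rewrite !int_mulrn.
  move: (p i : nat) (p j : nat) => s' t'.
  move: (Num.floor (x 0 i - _)) (Num.floor (x 0 j - _)) => u v; clear => e h1 h2.
  have e' : t'%:Z - s'%:Z = (q - v + u) * d.+1%:Z.
    by rewrite mulrDl mulrBl -e; ring.
  have Q0 : q - v + u = 0 by move: (q - v + u) e' => Q; nia.
  by move: e'; rewrite Q0 mul0r; lia.
apply: (cell_le_frac f01 (fun i => frac01 R (p i)) xf (_ : forall i j, _)).
  move=> i j; rewrite -chart_diff !scaled_pt_diff; congr (_ %:~R / _); exact: chX.
move=> i j h; apply: pf; move: h.
by rewrite ler_pM2r ?ler_nat// invr_gt0 ltr0Sn.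
Qed.

Lemma divz_opp (t : int) : ~ (exists q, t = q * n%:Z) ->
  divz (- t) n%:Z = - divz t n%:Z - 1.
Proof.
move=> nt.
have := divz_eq t n%:Z; have := divz_eq (- t) n%:Z.
have := modz_ge0 t (isT : n%:Z != 0); have := ltz_pmod t (isT : 0 < n%:Z).
have := modz_ge0 (- t) (isT : n%:Z != 0); have := ltz_pmod (- t) (isT : 0 < n%:Z).
have : (t %% n%:Z)%Z != 0.
  by apply/eqP => r0; apply: nt; exists (t %/ n%:Z)%Z;
    rewrite {1}(divz_eq t n%:Z) r0 addr0.
move: (t %% _)%Z ((- t) %% _)%Z (t %/ _)%Z ((- t) %/ _)%Z => r r' q q'.
move: n%:Z => N r0 h1 h2 h3 h4 e1 e2; clear nt.
have : (q + q' + 1) * N = N - r - r' by rewrite !mulrDl mul1r; lia.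
by nia.
Qed.

(* The two cells above a ridge differ by the order of one pair of coordinates
   that is tied on the ridge. *)
Lemma ridge_adj X Y z : Gamma_vertices X -> Gamma_vertices Y -> X <> Y ->
  cell_le z (center X) -> cell_le z (center Y) -> size (cell_verts z) = d ->
    Gamma_adj X Y.
Proof.
move=> gX gY XY zX zY /size_undup_predP[i [j [ij fij fu]]].
pose q := quo.
have qf (Z : 'rV[int]_n) u w : cell_le z (center Z) -> (q Z u w)%:~R <= z 0 w - z 0 u.
  by move=> zZ; apply: (cell_le_ge zZ); rewrite -quo_floor.
have qc (Z : 'rV[int]_n) u w : cell_le z (center Z) ->
  z 0 w - z 0 u <= (q Z u w + 1)%:~R.
  move=> zZ; apply: zZ; rewrite ltW// ltNge -quo_floor -/(q Z u w); lia.
(* Off the tied pair, [z_w - z_u] is not an integer, so both quotients equal its floor. *)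
have qE u w : u != w -> ~ (u = i /\ w = j \/ u = j /\ w = i) -> q X u w = q Y u w.
  move=> uw nij.
  have nz (m : int) : z 0 w - z 0 u <> m%:~R.
    by move=> e; apply: nij; apply: fu => //; apply/floor_row_eq; exists m.
  have le (Z Z' : 'rV[int]_n) : cell_le z (center Z) -> cell_le z (center Z') ->
    q Z u w <= q Z' u w.
    move=> zZ zZ'; rewrite leNgt -lezD1; apply/negP => h.
    apply: (nz (q Z' u w + 1)); apply/eqP; rewrite eq_le qc//=.
    by apply: le_trans (qf Z u w zZ); rewrite ler_int.
  by apply/eqP; rewrite eq_le !le.
have q0 (Z : 'rV[int]_n) u : q Z u u = 0 by rewrite /q /quo subrr div0z.
have qopp (Z : 'rV[int]_n) : Gamma_vertices Z -> q Z j i = - q Z i j - 1.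
  move=> gZ; rewrite /q /quo -opprB divz_opp// => -[m /(Gamma_inj gZ) e].
  by rewrite e eqxx in ij.
have YXu u : u != i -> u != j -> Y 0 u - X 0 u = 0.
  move=> ui uj; rewrite (Gamma_quot gX gY); apply: big1 => w _.
  have [<-|uw] := eqVneq u w; first by rewrite -/(q X u u) -/(q Y u u) !q0.
  rewrite -/(q X u w) -/(q Y u w) qE ?subrr// => -[[e _]|[e _]].
    by rewrite e eqxx in ui.
  by rewrite e eqxx in uj.
have YXi : Y 0 i - X 0 i = q X i j - q Y i j.
  rewrite (Gamma_quot gX gY) (bigD1 j)//= big1 ?addr0// => w wj.
  have [<-|iw] := eqVneq i w; first by rewrite -/(q X i i) -/(q Y i i) !q0.
  rewrite -/(q X i w) -/(q Y i w) qE ?subrr// => -[[_ e]|[e _]].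
    by rewrite e eqxx in wj.
  by rewrite e eqxx in ij.
have YXj : Y 0 j - X 0 j = - (q X i j - q Y i j).
  rewrite (Gamma_quot gX gY) (bigD1 i)//= big1 => [|w wi].
    by rewrite -/(q X j i) -/(q Y j i) !qopp//; ring.
  have [<-|jw] := eqVneq j w; first by rewrite -/(q X j j) -/(q Y j j) !q0.
  rewrite -/(q X j w) -/(q Y j w) qE ?subrr// => -[[e _]|[_ e]].
    by rewrite e eqxx in ij.
  by rewrite e eqxx in wi.
(* On the tied pair the difference is an integer [m], and each quotient is [m] or [m - 1]: the order
   in which the tie is broken. *)
have [m zm] : exists m : int, z 0 j - z 0 i = m%:~R by apply/floor_row_eq.
have bd (Z : 'rV[int]_n) : cell_le z (center Z) -> q Z i j <= m <= q Z i j + 1.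
  by move=> zZ; rewrite -!(ler_int R) -zm qf// qc.
have := bd X zX; have := bd Y zY; move: YXi YXj.
move: (q X i j) (q Y i j) => s t YXi YXj hX hY.
have [e|[e|e]] : s - t = 0 \/ s - t = 1 \/ s - t = -1 by lia.
- exfalso; apply: XY; apply/rowP => u; apply/esym/eqP; rewrite -subr_eq0.
  have [->|ui] := eqVneq u i; first by rewrite YXi e.
  have [->|uj] := eqVneq u j; first by rewrite YXj e.
  by rewrite YXu.
- exists j, i; split; first by rewrite eq_sym.
  apply/rowP => u; rewrite !rowvD !rowvN ![std_basis _ _ _ _]mxE eqxx /=.
  have [->|ui] := eqVneq u i; first by rewrite YXi e (negPf ij).
  have [->|uj] := eqVneq u j; first by rewrite YXj e.
  by rewrite YXu.
- exists i, j; split=> //.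
  apply/rowP => u; rewrite !rowvD !rowvN ![std_basis _ _ _ _]mxE eqxx /=.
  have [->|ui] := eqVneq u i; first by rewrite YXi e (negPf ij).
  have [->|uj] := eqVneq u j; first by rewrite YXj e opprK subr0.
  by rewrite YXu.
Qed.

(** For distinct coordinates, [X_w - X_u] is never a multiple of n, so a bound [m n] on it can be
    improved by 1. The doubled bound improves by 2, which absorbs the error allowed for [Z]. *)
Lemma midpoint_le X (Z : 'rV[int]_n) : Gamma_vertices X ->
  (forall u w, Z 0 w - Z 0 u <= (X 0 w - X 0 u) *+ 2 + 2) ->
  cell_le (scaled_pt R (n * 2) Z) (center X).
Proof.
move=> gX ZX u w m; rewrite center_le scaled_pt_diff => h.
have [uw|uw] := eqVneq u w.
  by rewrite uw subrr mul0r; move: h; rewrite uw subrr pmulr_lge0// ler0z.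
rewrite ler_pdivrMr ?ltr0n ?muln_gt0// -[(n * 2)%:R]/((n * 2)%N%:Z%:~R) -intrM ler_int.
have : X 0 w - X 0 u != m * n%:Z.
  by apply/eqP => /(Gamma_inj gX) e; rewrite e eqxx in uw.
have := ZX u w; move: h; rewrite PoszM mulrA mulr2n.
move: (m * n%:Z) (Z 0 w - Z 0 u) (X 0 w - X 0 u); clear => A B C; lia.
Qed.

Lemma adj_ridge X Y : (2 <= d)%N -> Gamma_vertices X -> Gamma_vertices Y ->
  Gamma_adj X Y ->
  exists z, [/\ hyperplane_V z, cell_le z (center X),
    cell_le z (center Y) & size (cell_verts z) = d].
Proof.
move=> d2 gX gY [i [j [ij YX]]].
have YE u : Y 0 u = X 0 u + ((u == j)%:Z - (u == i)%:Z).
  have := congr1 (fun V : 'rV[int]_n => V 0 u) YX.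
  rewrite /= !rowvD !rowvN ![std_basis _ _ _ _]mxE eqxx /= !natz => <-.
  by rewrite [RHS]addrC subrK.
pose Z := X + Y.
have ZE u : Z 0 u = X 0 u *+ 2 + ((u == j)%:Z - (u == i)%:Z).
  by rewrite /Z rowvD YE mulr2n addrA.
have ZE' u : Z 0 u = Y 0 u *+ 2 - ((u == j)%:Z - (u == i)%:Z).
  by rewrite ZE YE !mulr2n; ring.
(* The ridge is the cell of the midpoint of the two centers. *)
exists (scaled_pt R (n * 2) Z); split; first exact: scaled_pt_V.
- apply: midpoint_le => // u w; rewrite !ZE !mulr2n.
  by case: (w == j) (w == i) (u == j) (u == i) => [] [] [] []; lia.
- apply: midpoint_le => // u w; rewrite !ZE' !mulr2n.
  by case: (w == j) (w == i) (u == j) (u == i) => [] [] [] []; lia.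
have flE u w : int_pt R (floor_row (scaled_pt R (n * 2) Z 0 u) (scaled_pt R (n * 2)
  Z)) =
    int_pt R (floor_row (scaled_pt R (n * 2) Z 0 w) (scaled_pt R (n * 2) Z)) <->
    exists m, Z 0 w - Z 0 u = m * (n * 2)%N%:Z.
  have n2 : (n * 2)%:R != 0 :> R by rewrite pnatr_eq0.
  rewrite floor_row_eq scaled_pt_diff; split=> -[m e]; exists m.
    by apply: (@intr_inj R); rewrite intrM -e mulfVK.
  by rewrite e intrM mulfK.
apply: (@size_undup_pred _ _ _ i j) => //.
(* Some coordinate [w] of [Y] is congruent to [X_i]. It is not [i], as [Y_i = X_i - 1], nor any
   index other than [j], where [Y] agrees with [X]. Hence [X_j + 1] is congruent to [X_i], and
   [Z_j - Z_i] is divisible by 2n. *)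
- apply/flE; have [w [wX _]] := gY.2 (X 0 i).
  move: wX => /modnzP[q]; rewrite YE.
  have [->|wi] := eqVneq w i.
    rewrite (negPf ij) => e; exfalso.
    have {}e : -1 = q * n%:Z by move: e; move: (q * n%:Z) (X 0 i) => A B /=; lia.
    by move: e d2; clear; case: q => [[|q]|[|q]]; nia.
  have [->|wj] := eqVneq w j.
    have ji : (j == i) = false by rewrite eq_sym (negPf ij).
    move=> e; exists q; rewrite !ZE PoszM mulrA -e !mulr2n !eqxx ji (negPf ij).
    by move: (X 0 i) (X 0 j); clear => A B /=; lia.
  rewrite subrr addr0 => /(Gamma_inj gX) e; by rewrite e eqxx in wi.
move=> u w; rewrite !inE => ui wi /flE[m].
rewrite !ZE (negPf ui) (negPf wi) !subr0 PoszM mulrA !mulr2n => e.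
apply: (Gamma_inj gX (q := m)).
move: e; move: (m * n%:Z) (X 0 u) (X 0 w); clear => A B C.
by case: (u == j) (w == j) => [] []; lia.
Qed.

End GammaVertices.

(** * Classes modulo periods and the graph isomorphism *)

Section DualGraph.
Variables (R : realType) (d : nat) (k : 'I_d.+1 -> nat).
Hypothesis d_ge2 : (2 <= d)%N.
Hypothesis k_gt0 : forall i, (0 < k i)%N.
Notation n := d.+1.
Notation vec := 'rV[R]_n.
Notation T := (Tk R k).
Notation period := (@period R d k).
Notation cell_class := (@cell_class R d k).
Notation center := (@center R d).
Implicit Types (x y z : vec) (a b c X Y : 'rV[int]_n) (i j u w : 'I_n).

Let d_gt0 : (0 < d)%N. Proof. exact: ltn_trans d_ge2. Qed.

Definition period_int b : 'rV[int]_n :=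
  (b *m Mk k) *+ n - const_mx (\sum_i (b *m Mk k) 0 i).

Lemma rowv_mulrn (K : nmodType) m (v : 'rV[K]_m) l (j : 'I_m) : (v *+ l) 0 j = v 0 j
  *+ l.
Proof. by elim: l => [|l IH]; rewrite ?mulr0n ?mxE// !mulrS rowvD IH. Qed.

Lemma LkP X : Lk k X <-> exists b, X = period_int b.
Proof.
have E b : \sum_i (b *m Mk k) 0 i *: w_vec int i = period_int b.
  apply/rowP => j; rewrite summxE /period_int rowvD rowvN rowv_mulrn [const_mx _ _
    _]mxE.
  have e : \sum_(l < n) std_basis int l 0 j = 1.
    rewrite (bigD1 j)//= mxE !eqxx big1 ?addr0// => l /negPf lj.
    by rewrite mxE eqxx eq_sym lj.
  under eq_bigr => i _ do rewrite rowvZ /w_vec rowvD rowvN rowvZ summxE e mulrBr mulr1.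
  rewrite sumrB; congr (_ - _).
  rewrite (bigD1 j)//= big1 => [|i /negPf ij]; last first.
    by rewrite [std_basis _ _ _ _]mxE /= [j == i]eq_sym ij !mulr0.
  by rewrite [std_basis _ _ _ _]mxE ?eqxx /= mulr1 addr0 mulr_natr.
by split=> -[b ->]; exists b; rewrite E.
Qed.

Lemma period_intD b c : period_int (b + c) = period_int b + period_int c.
Proof.
apply/rowP => j; rewrite !rowvD !rowvN mulmxDl !rowv_mulrn !rowvD ![const_mx _ _
  _]mxE mulrnDl.
by under eq_bigr => i _ do rewrite rowvD; rewrite big_split /=; ring.
Qed.

Lemma period_intN b : period_int (- b) = - period_int b.
Proof.
apply/rowP => j; rewrite !rowvN !rowvD !rowvN mulNmx !rowv_mulrn !rowvN ![const_mx _
  _ _]mxE mulNrn.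
by under eq_bigr => i _ do rewrite rowvN; rewrite sumrN; ring.
Qed.

Lemma period_int0 : period_int 0 = 0.
Proof. by have := period_intD 0 0; rewrite addr0 => /eqP;
  rewrite -subr_eq0 opprD addrA subrr add0r oppr_eq0 => /eqP. Qed.

Lemma scaled_pt_const m X t : scaled_pt R m (X + const_mx t) = scaled_pt R m X.
Proof. by apply: vproj_eq => i j; rewrite !mxE !intrD; ring. Qed.

Lemma center_period X b : center (X + period_int b) = center X + period b.
Proof.
rewrite /center /period_int addrA -[- const_mx _]/(- const_mx _).
have -> : - const_mx (\sum_i (b *m Mk k) 0 i) = const_mx (- \sum_i (b *m Mk k) 0 i)
  :> 'rV[int]_n.
  by apply/rowP => i; rewrite !mxE.
by rewrite scaled_pt_const -scaled_pt_add_int.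
Qed.

Lemma Gamma_period X b : Gamma_vertices X -> Gamma_vertices (X + period_int b).
Proof.
move=> gX; apply: Gamma_intro.
  under eq_bigr => i _ do rewrite rowvD rowvD rowvN rowv_mulrn [const_mx _ _ _]mxE.
  by rewrite big_split sumrB /= sumr_const card_ord -sumrMnl subrr addr0; exact: gX.1.
move=> i j q; rewrite /period_int !rowvD !rowvN !rowv_mulrn ![const_mx _ _ _]mxE => e.
apply: (Gamma_inj gX (q := q - (b *m Mk k) 0 j + (b *m Mk k) 0 i)).
move: e; rewrite !int_mulrn mulrDl mulrBl => <-.
by move: (X 0 i) (X 0 j) (_ * n%:Z) (_ * n%:Z) (\sum_l _); clear => *; ring.
Qed.

Lemma period0_int b : period b = 0 -> period_int b = 0.
Proof.
rewrite /period -(int_pt0 R d) => /int_pt_eq[t]; rewrite add0r => e.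
rewrite /period_int e; apply/rowP => j;
  rewrite rowvD rowvN rowv_mulrn ![const_mx _ _ _]mxE.
under eq_bigr => i _ do rewrite mxE.
by rewrite sumr_const card_ord subrr.
Qed.

(** A difference of two edge vectors has entries between -2 and 2, whence the bound 4. Since 4 is at
    most 2n, the rescaled period has spread at most 2 and so vanishes. *)
Lemma period_int_small b : (forall i j, period_int b 0 j - period_int b 0 i <= 4) ->
  period_int b = 0.
Proof.
move=> h; apply: period0_int; apply: period_sparse => //.
have -> : period b = center (period_int b).
  have := center_period 0 b; rewrite add0r => ->; rewrite -[LHS]add0r; congr (_ + _).
  by rewrite /center /scaled_pt -[LHS](vproj_const d (0 : R));
    apply: vproj_eq => i j; rewrite !mxE !mul0r.
apply/spread_leP; split=> // i j; rewrite -[2]/(2%:~R) center_le.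
by apply: le_trans (h i j) _; lia.
Qed.

Lemma std_bound (i j u : 'I_n) :
  -1 <= (std_basis int j - std_basis int i) 0 u <= 1.
Proof. by rewrite rowvD rowvN !mxE eqxx /=; do 2 case: (u == _). Qed.

Lemma cell_class_center X Y : Gamma_vertices X -> Gamma_vertices Y ->
  cell_class (center X) = cell_class (center Y) <-> exists b, Y = X + period_int b.
Proof.
move=> gX gY; rewrite cell_class_eqP; [|exact: scaled_pt_V|exact: scaled_pt_V];
  split=> -[b].
  rewrite -center_period => -[/Gamma_eq e _]; exists b; apply/esym/e => //.
  exact: Gamma_period.
by move=> ->; exists b; rewrite center_period; split; exact: cell_le_refl.
Qed.

(** The cell of a center already has d+1 vertices, the maximal number, so no larger cell contains
    it; [Gamma_exists] puts every cell inside one of these. *)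
Lemma facets_center (C : face_type T) : facets C <->
  exists2 X, Gamma_vertices X & C = cell_class (center X).
Proof.
split=> [[/facesP[x Vx ->] h]|[X gX ->]].
  have [X gX xX] := Gamma_exists x; exists X => //.
  apply/esym/h; first exact/faces_cell_class/scaled_pt_V.
  by apply/containedP => //; [exact: scaled_pt_V|exists 0; rewrite period0 addr0].
split; first exact/faces_cell_class/scaled_pt_V.
move=> _ /facesP[y Vy ->] /containedP[]; [exact: scaled_pt_V|exact: Vy|move=> b Xy].
apply/cell_class_eqP => //; first exact: scaled_pt_V.
exists (- b); rewrite -center_period in Xy.
have gXb := Gamma_period b gX.
have yX : cell_le y (center (X + period_int b)).
  apply/cell_le_verts; have /cell_le_verts sub := Xy.
  have [|_ h] := uniq_min_size (cell_verts_uniq _) sub.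
    by rewrite (Gamma_size _ gXb) cell_verts_size.
  by move=> v; rewrite h.
rewrite center_period in yX Xy; rewrite periodN; split.
  by have := cell_le_add_int (a := (- b) *m Mk k) yX;
    rewrite -/(period _) periodN addrK.
by have := cell_le_add_int (a := (- b) *m Mk k) Xy; rewrite -/(period _) periodN addrK.
Qed.

(** Taking images of whole classes avoids choosing representatives: a coset of [Lk k] goes to the
    full orbit of a facet. *)
Definition node_map (A : node_type (Gk k)) : node_type (dual_graph T) :=
  [set cell (center X) | X in A].

Definition edge_map (E : edge_type (Gk k)) : edge_type (dual_graph T) :=
  [set cell_class (center X) | X in \bigcup_(e in E) e].

Lemma node_mapE X : node_map (translate X (Lk k)) = cell_class (center X).
Proof.
rewrite cell_classE; apply/seteqP; split=> [_ [_ [_ /LkP[b ->] <-] <-]|_ [b _ <-]].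
  by exists b => //; rewrite -center_period addrC.
exists (X + period_int b); last by rewrite center_period.
by exists (period_int b); [apply/LkP; exists b|rewrite addrC].
Qed.

Lemma edge_mapE X Y : edge_map (set_class (Lk k) [set X; Y]) =
  [set cell_class (center X); cell_class (center Y)].
Proof.
apply/seteqP; split.
  move=> _ [_ [_ [_ /LkP[b ->] <-] [Z XY <-]] <-].
  by rewrite center_period cell_class_period; case: XY => ->; [left|right].
have h Z : [set X; Y] Z -> edge_map (set_class (Lk k) [set X;
  Y]) (cell_class (center Z)).
  move=> hZ; exists Z => //; exists [set X; Y] => //; exists 0.
    by apply/LkP; exists 0; rewrite period_int0.
  by apply/seteqP; split=> [_ [Z' hZ' <-]|Z' hZ']; [rewrite addr0|exists Z';
    rewrite ?addr0].
by move=> _ [->|->]; apply: h; [left|right].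
Qed.

Lemma coset_period X b : translate (X + period_int b) (Lk k) = translate X (Lk k).
Proof.
apply/seteqP; split=> _ [_ /LkP[c ->] <-].
  by exists (period_int (c + b)); [apply/LkP;
    exists (c + b)|rewrite period_intD -addrA [period_int b + X]addrC].
by exists (period_int (c - b)); [apply/LkP;
  exists (c - b)|rewrite period_intD period_intN [X + _]addrC addrA subrK].
Qed.

Lemma set_class_period X Y b : set_class (Lk k) [set X + period_int b;
  Y + period_int b] =
  set_class (Lk k) [set X; Y].
Proof.
have tr v : translate v [set X + period_int b;
  Y + period_int b] = translate (v + period_int b) [set X; Y].
  apply/seteqP; split=> _ [Z [->|->] <-].
  - by exists X; [left|rewrite -addrA [v + _]addrC].
  - by exists Y; [right|rewrite -addrA [v + _]addrC].
  - by exists (X + period_int b); [left|rewrite -addrA [v + _]addrC].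
  - by exists (Y + period_int b); [right|rewrite -addrA [v + _]addrC].
apply/seteqP; split=> _ [_ /LkP[c ->] <-].
  by exists (period_int (c + b)); [apply/LkP; exists (c + b)|rewrite tr period_intD].
by exists (period_int (c - b)); [apply/LkP;
  exists (c - b)|rewrite tr period_intD period_intN subrK].
Qed.

Lemma adj_sym X Y : Gamma_adj X Y -> Gamma_adj Y X.
Proof.
move=> [i [j [ij e]]]; exists j, i; split; first by rewrite eq_sym.
by rewrite -opprB e opprB.
Qed.

(** G_k has no parallel edges: edges at [X] leading to the same class have the same end point. *)
Lemma adj_period X Y b : Gamma_adj X (Y + period_int b) -> Gamma_adj X Y ->
  period_int b = 0.
Proof.
move=> [i [j [_ e]]] [i' [j' [_ e']]]; apply: period_int_small => u w.
have -> : period_int b = (std_basis int j - std_basis int i) - (std_basis int j' -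
  std_basis int i').
  by rewrite -e -e'; apply/rowP => l; rewrite !rowvE; ring.
rewrite [X in X - _]rowvD [X in _ - X]rowvD !(rowvN (_ - _)).
have h (p q r s : int) : -1 <= p <= 1 -> -1 <= q <= 1 -> -1 <= r <= 1 ->
  -1 <= s <= 1 -> p - q - (r - s) <= 4 by lia.
by apply: h; exact: std_bound.
Qed.

(** G_k has no loops, so adjacent vertices yield distinct facets. *)
Lemma adj_neq X Y b : Gamma_adj X Y -> Y <> X + period_int b.
Proof.
move=> [i [j [ij e]]] Yb.
have lb : period_int b = std_basis int j - std_basis int i
  by rewrite -e Yb addrAC subrr add0r.
have : period_int b = 0.
  apply: period_int_small => u w; rewrite lb.
  have h (p q : int) : -1 <= p <= 1 -> -1 <= q <= 1 -> p - q <= 4 by lia.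
  by apply: h; exact: std_bound.
rewrite lb => /(congr1 (fun V : 'rV[int]_n => V 0 j)).
by rewrite rowvD rowvN !mxE !eqxx /= eq_sym (negPf ij).
Qed.

Lemma dual_graph_iso : graph_isomorphic (Gk k) (dual_graph T).
Proof.
exists node_map, edge_map; split.
- split.
  + by move=> _ [X gX <-]; rewrite node_mapE; apply/facets_center; exists X.
  + move=> _ _ /set_mem[X gX <-] /set_mem[Y gY <-]; rewrite !node_mapE.
    by move=> /(cell_class_center gX gY)[b ->]; rewrite coset_period.
  + move=> C /facets_center[X gX ->]; exists (translate X (Lk k));
    last exact: node_mapE.
    by exists X.
- split.
  + move=> _ [_ [X [Y [gX gY XY ->]]] <-]; rewrite edge_mapE.
    exists (cell_class (center X)), (cell_class (center Y)); split => //.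
    * by apply/facets_center; exists X.
    * by apply/facets_center; exists Y.
    * by move=> /(cell_class_center gX gY)[b]; exact: adj_neq.
    have [z [Vz zX zY sz]] := adj_ridge R d_ge2 gX gY XY.
    exists (cell_class z); split; first exact: faces_cell_class.
    * by apply/containedP => //; [exact: scaled_pt_V|exists 0; rewrite period0 addr0].
    * by apply/containedP => //; [exact: scaled_pt_V|exists 0; rewrite period0 addr0].
    * rewrite !face_dimE//; [|exact: scaled_pt_V]; rewrite sz Gamma_size//= prednK//.
    * rewrite !face_dimE//; [|exact: scaled_pt_V]; rewrite sz Gamma_size//= prednK//.
  + move=> _ _ /set_mem[_ [X [Y [gX gY XY ->]]] <-] /set_mem[_ [X' [Y' [gX' gY' XY'
    ->]]] <-].
    rewrite !edge_mapE => e.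
    (* Swapping the end points of the second edge if necessary. *)
    wlog : X' Y' gX' gY' XY' e / cell_class (center X) = cell_class (center X').
      move=> H; have : [set cell_class (center X');
        cell_class (center Y')] (cell_class (center X)) by rewrite -e; left.
      move=> [eX|eX]; first exact: H.
      rewrite (setUC [set X']); apply: H => //; first exact: adj_sym.
      by rewrite e setUC.
    move=> eX; have eY : cell_class (center Y) = cell_class (center Y').
      have : [set cell_class (center X');
        cell_class (center Y')] (cell_class (center Y)) by rewrite -e; right.
      move=> [|//]; rewrite -eX => /(cell_class_center gY gX)[b Xb]; exfalso.
      exact: (adj_neq (adj_sym XY) Xb).
    move/(cell_class_center gX gX') : eX => [b Xb];
      move/(cell_class_center gY gY') : eY => [c Yc].
    have adjb : Gamma_adj X (Y + period_int (c - b)).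
      have [i [j [ij eXY]]] := XY'; exists i, j; split=> //;
        rewrite -eXY Xb Yc period_intD period_intN.
      by apply/rowP => l; rewrite !rowvE; ring.
    have := adj_period adjb XY; rewrite period_intD period_intN => /eqP;
      rewrite subr_eq0 => /eqP cb.
    by rewrite Xb Yc cb set_class_period.
  + move=> _ [F [G [/facets_center[X gX ->] /facets_center[Y gY ->] FG [E [fE EF EG
    dF dG]] ->]]].
    move: fE EF EG dF => /facesP[z Vz ->].
    move=> /containedP[//||b zX]; first exact: scaled_pt_V.
    move=> /containedP[//||c zY]; first exact: scaled_pt_V.
    rewrite !face_dimE//; [|exact: scaled_pt_V]; rewrite Gamma_size//= => sz.
    (* The common ridge has lifts [z + period b] below [X] and [z + period c] below [Y]; moving [Y]
       by the difference puts the same lift below both. *)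
    pose Y' := Y + period_int (b - c).
    have clsY : cell_class (center Y') = cell_class (center Y)
      by rewrite /Y' center_period cell_class_period.
    have zY' : cell_le (z + period b) (center Y').
      have := cell_le_add_int (a := (b - c) *m Mk k) zY;
        rewrite -/(period _) -center_period.
      by rewrite periodD periodN addrA [z + _ + _]addrAC addrK.
    have szb : size (cell_verts (z + period b)) = d.
      have [_ <-] := card_vertices_of d_gt0 k_gt0 (VD_period k b Vz).
      have [_ e] := card_vertices_of d_gt0 k_gt0 Vz; rewrite cell_class_period e.
      by move: sz; case: (size _) => //=; lia.
    have XY : Gamma_adj X Y'.
      apply: ridge_adj zX zY' szb => //; first exact: Gamma_period.
      by move=> e; apply: FG; rewrite -clsY -e.
    exists (set_class (Lk k) [set X; Y']); last by rewrite edge_mapE clsY.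
    exists [set X; Y'] => //; exists X, Y'; split=> //; exact: Gamma_period.
- move=> _ _ [X gX <-] [_ [Y [Z [gY gZ YZ ->]]] <-].
  rewrite node_mapE edge_mapE; split.
    move=> [_ [_ [[_ /LkP[b ->] <-] [_ /LkP[c ->] <-] [W YZW]]]].
    move=> e; have -> : cell_class (center X) = cell_class (center W).
      by rewrite -(cell_class_period k _ b) -center_period [X + _]addrC -e
        center_period cell_class_period.
    by case: YZW => ->; [left|right].
  have h W : Gamma_vertices W -> [set Y;
    Z] W -> cell_class (center X) = cell_class (center W) ->
      incident (g := Gk k) (translate X (Lk k)) (set_class (Lk k) [set Y; Z]).
    move=> gW YZW /(cell_class_center gX gW)[b Wb]; exists W, [set Y; Z]; split=> //.
      by exists (period_int b); [apply/LkP; exists b|rewrite Wb addrC].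
    exists 0; first by apply/LkP; exists 0; rewrite period_int0.
    by apply/seteqP; split=> [_ [Z' hZ' <-]|Z' hZ']; [rewrite addr0|exists Z';
      rewrite ?addr0].
  by move=> [|] e; [apply: (h Y)|apply: (h Z)] => //; [left|right].
Qed.

End DualGraph.

Theorem theorem2p5 (R : realType) (d : nat) (k : 'I_d.+1 -> nat)
    (hd : (2 <= d)%N) (hk : forall i, (0 < k i)%N) :
  triangulation_of R (Tk R k) (@torus R d) /\
  graph_isomorphic (Gk k) (dual_graph (Tk R k)) /\
  (forall C : face_type (Tk R k), faces C -> (face_dim C <= d)%N) /\
  (forall i : nat, (i <= d)%N ->
    (f_vector (Tk R k) i)%:R =
      i`!%:R * stirling2 d.+1 i.+1 * (Dk k)%:~R :> rat) /\
  Dk k = \prod_i (k i).+1%:Z - \prod_i (k i)%:Z /\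
  (f_vector (Tk R k) 0)%:Z = Dk k /\
  (f_vector (Tk R k) d)%:Z = d`!%:Z * Dk k /\
  (f_vector (Tk R k) d.-1)%:R = (d.+1)`!%:R / 2 * (Dk k)%:~R :> rat.
Proof.
have d_gt0 : (0 < d)%N by exact: ltn_trans hd.
split; first by split; [exact: Tk_simplicial|exact: Tk_finite|exact: Tk_torus].
split; first exact: dual_graph_iso.
split; first by move=> C; exact: face_dim_le.
split; first by move=> i _; exact: f_vectorE.
split; first exact: det_Mk.
split.
  by rewrite (f_vector_int R d_gt0 hk (n := 1)) ?mul1r// stirling2_1r.
split; first by rewrite (f_vector_int R d_gt0 hk (n := d`!))// stirling2_diag mulr1.
rewrite f_vectorE//; congr (_ * _); rewrite prednK//.
case: d {k hk} hd d_gt0 => // n _ _ /=.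
rewrite stirling2_subdiag -(bin_fact (n := n.+2) (m := 2))// subSS subSS subn0 !natrM.
by field.
Qed.
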